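(* Fix a constant $\kappa>0$. Let $X$ and $Y$ be any two oriented points in $T\mathbb{R}^2$, $X\neq Y$, such that $(X,Y)\in\nabla\mathcal{O}$. Then for any $s\in[\ell_m,\ell_1]\cup[\ell_2,+\infty)$ there exists a curvature-bounded path $\gamma\in\Gamma(X,Y)$ such that $\ell(\gamma)=s$.
   Context: An oriented point is an element $X=(\boldsymbol{x},\boldsymbol{v})$ of the tangent bundle $T\mathbb{R}^2$, with $\boldsymbol{x}\in\mathbb{R}^2$ and $\boldsymbol{v}$ a (unit) tangent vector at $\boldsymbol{x}$. Fix $\kappa>0$. A curvature-bounded path from $X=(\boldsymbol{x},\boldsymbol{v})$ to $Y=(\boldsymbol{y},\boldsymbol{w})$ is a map $\gamma:[0,s]\to\mathbb{R}^2$ that is $C^1$ and piecewise $C^2$, parameterised by arc length ($\|\gamma'(t)\|=1$ for all $t$), with $\gamma(0)=\boldsymbol{x}$, $\gamma'(0)=\boldsymbol{v}$, $\gamma(s)=\boldsymbol{y}$, $\gamma'(s)=\boldsymbol{w}$, and $\|\gamma''(t)\|\leq\kappa$ wherever $\gamma''(t)$ is defined. For $X\ne Y$, $\Gamma(X,Y)$ is the set of all such paths and $\ell(\gamma)$ is the length of $\gamma$. $\gamma_m$ denotes the shortest path in $\Gamma(X,Y)$ (a fixed one, should there be several) and $\ell_m=\ell(\gamma_m)>0$. Path types: $\mathrm{C}$ is an arc of a circle of radius $1/\kappa$, right-turning ($\mathrm{R}$) or left-turning ($\mathrm{L}$), and $\mathrm{S}$ is a straight line segment; a word denotes the ($C^1$)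 concatenation. $\mathrm{C}_\eta$ is an arc of radian measure $\eta\geq 0$, $\mathrm{S}_d$ a segment of length $d\ge 0$. $\mathrm{CSC}$ means one of $\mathrm{RSR},\mathrm{RSL},\mathrm{LSR},\mathrm{LSL}$. $\boldsymbol{c}_X^r$ and $\boldsymbol{c}_X^l$ are the centers of the circles of radius $1/\kappa$ through $\boldsymbol{x}$, tangent to $\boldsymbol{v}$, lying respectively to the right and to the left of $X$; likewise $\boldsymbol{c}_Y^r,\boldsymbol{c}_Y^l$ for $Y$. Let $d(\cdot,\cdot)$ be the Euclidean distance. Define $\mathcal{O}\subset(T\mathbb{R}^2)^2$ as the set of $(X,Y)$ such that $\gamma_m$ is of type $\mathrm{C}_\eta\mathrm{S}_d\mathrm{C}_\xi$ and at least one of the following holds: $\eta\geq\pi$; $\xi\geq\pi$; $d\geq 4/\kappa$; $d(\boldsymbol{c}_X^r,\boldsymbol{c}_Y^r)\geq 4/\kappa$; $d(\boldsymbol{c}_X^l,\boldsymbol{c}_Y^l)\geq 4/\kappa$. Define $\nabla\mathcal{O}$ as the set of $(X,Y)$ such that $\gamma_m$ is of type $\mathrm{CSC}$ and $(X,Y)\notin\mathcal{O}$. For $(X,Y)\in\nabla\mathcal{O}$ there are two $\mathrm{RLR}$-paths and two $\mathrm{LRL}$-paths from $X$ to $Y$; $\ell^s_{\mathrm{RLR}},\ell^l_{\mathrm{RLR}}$ denote the lengths of the shorter and the longer $\mathrm{RLR}$-path, and $\ell^s_{\mathrm{LRL}},\ell^l_{\mathrm{LRL}}$ those of the shorter and the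 longer $\mathrm{LRL}$-path. $\ell_{\mathrm{RSR}},\ell_{\mathrm{RSL}},\ell_{\mathrm{LSR}},\ell_{\mathrm{LSL}}$ are the lengths of the $\mathrm{RSR}$-, $\mathrm{RSL}$-, $\mathrm{LSR}$-, $\mathrm{LSL}$-paths from $X$ to $Y$. Any of these lengths is set to $+\infty$ if the corresponding path does not exist. Set $$\ell_1=\max\{\ell^s_{\mathrm{LRL}},\ell^s_{\mathrm{RLR}}\},\qquad \ell_2=\min\Big(\{\ell_m+2\pi/\kappa,\ \ell^l_{\mathrm{LRL}},\ \ell^l_{\mathrm{RLR}}\}\cup\big(\{\ell_{\mathrm{RSR}},\ell_{\mathrm{RSL}},\ell_{\mathrm{LSR}},\ell_{\mathrm{LSL}}\}\setminus\{\ell_m\}\big)\Big).$$ *)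

(* Defs.v *)
(* The plane R^2 is Coquelicot's C = R * R, so Cmod is the Euclidean norm and
   multiplying by Ci turns a vector by a quarter turn to the left. *)
From Stdlib Require Import Reals List.
From Coquelicot Require Import Coquelicot.
Import ListNotations.
Open Scope R_scope.

(* (x, v): the vector v at the point x. *)
Definition tangent_bundle : Type := (C * C)%type.
Definition base (X : tangent_bundle) : C := fst X.
Definition dir (X : tangent_bundle) : C := snd X.

Definition oriented_point (X : tangent_bundle) : Prop := Cmod (dir X) = 1.

(* A map [0, dom_end] -> R^2; the values of [trace] outside are irrelevant,
   which is why derivatives below are taken within the interval. *)
Record path : Type := Path { dom_end : R; trace : R -> C }.

Definition interval (a b : R) : R -> Prop := fun t => a <= t <= b.

(* One-sided at the endpoints when D is a nondegenerate closed interval. *)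
Definition derivative_within (D : R -> Prop) (f : R -> C) (t : R) (l : C)
  : Prop :=
  D_in (fun u => Re (f u)) (fun _ => Re l) D t /\
  D_in (fun u => Im (f u)) (fun _ => Im l) D t.

Definition continuous_within (D : R -> Prop) (f : R -> C) (t : R) : Prop :=
  continue_in (fun u => Re (f u)) D t /\ continue_in (fun u => Im (f u)) D t.

(* On [a, b], f is C^1 with derivative f'. *)
Definition C1_with (a b : R) (f f' : R -> C) : Prop :=
  forall t, a <= t <= b ->
    derivative_within (interval a b) f t (f' t) /\
    continuous_within (interval a b) f' t.

Definition piecewise_C1 (a b : R) (f : R -> C) : Prop :=
  exists (n : nat) (tau : nat -> R),
    tau 0%nat = a /\ tau n = b /\
    forall i, (i < n)%nat ->
      tau i < tau (S i) /\
      exists f' : R -> C, C1_with (tau i) (tau (S i)) f f'.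

(* Membership in Gamma(X, Y).  The witness g1 is the derivative of the path;
   being C^1 and piecewise C^2 means that g1 is continuous and piecewise
   C^1. *)
Definition Gamma (kappa : R) (X Y : tangent_bundle) (g : path) : Prop :=
  0 <= dom_end g /\
  exists g1 : R -> C,
    C1_with 0 (dom_end g) (trace g) g1 /\
    piecewise_C1 0 (dom_end g) g1 /\
    (forall t, 0 <= t <= dom_end g -> Cmod (g1 t) = 1) /\
    trace g 0 = base X /\ g1 0 = dir X /\
    trace g (dom_end g) = base Y /\ g1 (dom_end g) = dir Y /\
    (forall (t : R) (a : C), 0 <= t <= dom_end g ->
       derivative_within (interval 0 (dom_end g)) g1 t a -> Cmod a <= kappa).

Definition path_length (g : path) : R :=
  RInt (fun t => Cmod (Derive (fun u => Re (trace g u)) t,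
                       Derive (fun u => Im (trace g u)) t)) 0 (dom_end g).

Definition shortest (kappa : R) (X Y : tangent_bundle) (g : path) : Prop :=
  Gamma kappa X Y g /\
  forall h, Gamma kappa X Y h -> path_length g <= path_length h.

Inductive turn : Type := Right | Left.

Definition opposite (a : turn) : turn :=
  match a with Right => Left | Left => Right end.

Definition turn_sign (a : turn) : R :=
  match a with Right => -1 | Left => 1 end.

Definition center (kappa : R) (a : turn) (X : tangent_bundle) : C :=
  (base X + RtoC (turn_sign a / kappa) * (Ci * dir X))%C.

Definition cis (theta : R) : C := (cos theta, sin theta).

(* [Arc a eta] has radian measure eta, [Seg d] has length d. *)
Inductive piece : Type := Arc (a : turn) (eta : R) | Seg (d : R).

Definition measure (p : piece) : R :=
  match p with Arc _ eta => eta | Seg d => d end.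

Definition piece_length (kappa : R) (p : piece) : R :=
  match p with Arc _ eta => eta / kappa | Seg d => d end.

Fixpoint word_length (kappa : R) (w : list piece) : R :=
  match w with
  | [] => 0
  | p :: w' => piece_length kappa p + word_length kappa w'
  end.

(* The oriented point reached from X after arc length t along a piece of the
   given kind: an arc rotates X about the corresponding center. *)
Definition advance (kappa : R) (p : piece) (t : R) (X : tangent_bundle)
  : tangent_bundle :=
  match p with
  | Seg _ => ((base X + RtoC t * dir X)%C, dir X)
  | Arc a _ =>
      let c := center kappa a X in
      let rot := cis (turn_sign a * kappa * t) in
      ((c + rot * (base X - c))%C, (rot * dir X)%C)
  end.

(* The point at arc length t on the C^1 concatenation of the pieces of w,
   started at X. *)
Fixpoint word_trace (kappa : R) (w : list piece) (X : tangent_bundle) (t : R)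
  : C :=
  match w with
  | [] => base X
  | p :: w' =>
      if Rle_dec t (piece_length kappa p) then base (advance kappa p t X)
      else word_trace kappa w' (advance kappa p (piece_length kappa p) X)
             (t - piece_length kappa p)
  end.

Definition of_type (kappa : R) (X : tangent_bundle) (w : list piece)
    (g : path) : Prop :=
  List.Forall (fun p => 0 <= measure p) w /\
  dom_end g = word_length kappa w /\
  forall t, 0 <= t <= dom_end g -> trace g t = word_trace kappa w X t.

(* (X, Y) is in O, respectively in nabla O, gm being the chosen shortest path
   from X to Y. *)
Definition in_O (kappa : R) (X Y : tangent_bundle) (gm : path) : Prop :=
  exists (a b : turn) (eta d xi : R),
    of_type kappa X [Arc a eta; Seg d; Arc b xi] gm /\
    (PI <= eta \/ PI <= xi \/ 4 / kappa <= d \/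
     4 / kappa <= Cmod (center kappa Right X - center kappa Right Y)%C \/
     4 / kappa <= Cmod (center kappa Left X - center kappa Left Y)%C).

Definition in_nabla_O (kappa : R) (X Y : tangent_bundle) (gm : path) : Prop :=
  (exists (a b : turn) (eta d xi : R),
     of_type kappa X [Arc a eta; Seg d; Arc b xi] gm) /\
  ~ in_O kappa X Y gm.

(* The lengths of the CSC-paths (CCC-paths) from X to Y with given turns; arcs
   making a full turn or more are excluded, so that these sets are finite. *)
Definition CSC_lengths (kappa : R) (X Y : tangent_bundle) (a b : turn) (l : R)
  : Prop :=
  exists (g : path) (eta d xi : R),
    Gamma kappa X Y g /\ of_type kappa X [Arc a eta; Seg d; Arc b xi] g /\
    eta < 2 * PI /\ xi < 2 * PI /\ l = path_length g.

Definition CCC_lengths (kappa : R) (X Y : tangent_bundle) (a : turn) (l : R)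
  : Prop :=
  exists (g : path) (eta theta xi : R),
    Gamma kappa X Y g /\
    of_type kappa X [Arc a eta; Arc (opposite a) theta; Arc a xi] g /\
    eta < 2 * PI /\ theta < 2 * PI /\ xi < 2 * PI /\ l = path_length g.

(* There is at most one CSC-path with given turns, except when the first and
   last arcs lie on the same circle (a = b, d = 0) and an additional full turn
   may fit; the infimum then discards the latter.  It is p_infty on the empty
   set. *)
Definition CSC_length (kappa : R) (X Y : tangent_bundle) (a b : turn) : Rbar :=
  Glb_Rbar (CSC_lengths kappa X Y a b).

(* CCC_shorter kappa X Y Right is the length of the shorter RLR-path, and so
   on. *)
Definition CCC_shorter (kappa : R) (X Y : tangent_bundle) (a : turn) : Rbar :=
  Glb_Rbar (CCC_lengths kappa X Y a).

(* The supremum of a set of lengths is m_infty only if the set is empty. *)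
Definition CCC_longer (kappa : R) (X Y : tangent_bundle) (a : turn) : Rbar :=
  match Lub_Rbar (CCC_lengths kappa X Y a) with
  | m_infty => p_infty
  | l => l
  end.

(* The sets below are finite and nonempty: lub and glb are max and min. *)
Definition ell1 (kappa : R) (X Y : tangent_bundle) : Rbar :=
  Rbar_lub (fun l => l = CCC_shorter kappa X Y Left \/
                     l = CCC_shorter kappa X Y Right).

Definition ell2 (kappa : R) (X Y : tangent_bundle) (gm : path) : Rbar :=
  Rbar_glb (fun l =>
    l = Finite (path_length gm + 2 * PI / kappa) \/
    l = CCC_longer kappa X Y Left \/
    l = CCC_longer kappa X Y Right \/
    ((exists a b : turn, l = CSC_length kappa X Y a b) /\
     l <> Finite (path_length gm))).

(* Main.v *)
(* Any two oriented points differ by a plane motion, and a word of arcs and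
   segments joins them when its own motion is that one; lengths are then sums of
   radian measures, for kappa = 1.

   A word containing an arc of measure at least pi can be lengthened at will: cut
   out a half turn and put equal segments before and after it.  Inserting a full
   turn into the shortest path gives [l_m + 2 pi / kappa, +oo).  Every CCC path has
   a partner, obtained by reflecting the middle circle, and one of the two has an
   arc of measure at least pi.  A CSC path without such an arc is unique in length,
   so it is as long as gm.

   For [l_m, l_1], keep the heading of the segment of gm and prolong the arcs
   adjacent to it, each preceded (or followed) by a counter-turn, so that the two
   lateral displacements cancel.  The segment shrinks continuously; either it
   vanishes, and a CCC path is reached, or an arc reaches measure pi first, and then
   all lengths from l_m on occur. *)
Require Import Defs.
From Stdlib Require Import Reals List Lra Lia Classical.
From Coquelicot Require Import Coquelicot.
Import ListNotations.
Open Scope R_scope.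

(** * Words as curvature-bounded paths *)

(** Both bounds on [s] serve as inequalities against sets of lengths, so it never has to be known
    which path realises an extremum. If [s] is at most [ell1], it is at most every length of one CCC
    type; a deformation aimed at that type cannot end, short of [s], in a CCC word of that type, and
    its other outcomes all realise [s].

    The parameter of the deformation is the common decrease of the cosines of the two prolonged
    arcs: prolonging an arc from measure [eta] to [p] behind a counter-turn shifts the segment
    sideways by twice [cos p - cos eta], up to sign, so equal decreases cancel. An outer arc with
    the wrong turn counts as a counter-turn next to a null arc. Beyond a quarter turn an arc can
    make the segment grow again, so its length is not monotone, and the deformation must be stopped
    before that length becomes negative.

    For paths, the obstacle is that the curvature condition concerns every point where a second
    derivative happens to exist, joints of pieces included. A Lipschitz bound on the heading covers
    all of them at once. *)

Lemma C_ext (z w : C) : Re z = Re w -> Im z = Im w -> z = w.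
Proof. destruct z, w; simpl; congruence. Qed.

Lemma cis_add (a b : R) : cis (a + b) = (cis a * cis b)%C.
Proof. unfold cis; rewrite cos_plus, sin_plus; apply C_ext; simpl; ring. Qed.

Lemma cis_0 : cis 0 = 1%C.
Proof. unfold cis; rewrite cos_0, sin_0; reflexivity. Qed.

Lemma Cmod_cis (a : R) : Cmod (cis a) = 1.
Proof.
  unfold Cmod, cis; simpl fst; simpl snd.
  replace (cos a ^ 2 + sin a ^ 2) with 1; [apply sqrt_1 |].
  generalize (sin2_cos2 a); unfold Rsqr; lra.
Qed.

Lemma Cmod_Ci : Cmod Ci = 1.
Proof.
  unfold Cmod, Ci; simpl; replace (0 * (0 * 1) + 1 * (1 * 1)) with 1 by ring; apply sqrt_1.
Qed.

Lemma Rabs_sin_le (x : R) : Rabs (sin x) <= Rabs x.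
Proof.
  assert (Hpos : forall y, 0 <= y -> Rabs (sin y) <= y).
  { intros y Hy; destruct (Rle_dec y 1) as [H1 | H1].
    - assert (HP := PI2_1); assert (Hs : 0 <= sin y) by (apply sin_ge_0; lra).
      rewrite Rabs_right by lra.
      destruct (Req_dec y 0) as [-> | H0]; [rewrite sin_0; lra |].
      apply Rlt_le, sin_lt_x; lra.
    - assert (HB := SIN_bound y); apply Rabs_le; lra. }
  destruct (Rle_dec 0 x) as [H | H].
  - rewrite (Rabs_right x) by lra; now apply Hpos.
  - rewrite (Rabs_left x), <- Rabs_Ropp, <- sin_neg by lra; apply Hpos; lra.
Qed.

(** A chord is no longer than its arc: factoring out the midpoint angle leaves twice the sine of
    half the difference. *)
Lemma lipschitz_cis (a b : R) : Cmod (cis a - cis b)%C <= Rabs (a - b).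
Proof.
  set (m := (a + b) / 2); set (h := (a - b) / 2).
  replace (cis a - cis b)%C with (RtoC (2 * sin h) * (Ci * cis m))%C.
  - rewrite !Cmod_mult, Cmod_cis, Cmod_R, Cmod_Ci.
    rewrite Rabs_mult, (Rabs_right 2) by lra.
    assert (H := Rabs_sin_le h).
    replace (a - b) with (2 * h) by (unfold h; field).
    rewrite Rabs_mult, (Rabs_right 2) by lra; lra.
  - replace a with (m + h) by (unfold m, h; field).
    replace b with (m - h) by (unfold m, h; field).
    unfold cis; rewrite cos_plus, cos_minus, sin_plus, sin_minus.
    apply C_ext; simpl; ring.
Qed.

(** * Gluing maps, and passing to derivatives within an interval *)

Definition has_derivative (f f' : R -> C) : Prop :=
  forall t, is_derive (fun u => Re (f u)) t (Re (f' t)) /\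
            is_derive (fun u => Im (f u)) t (Im (f' t)).

Definition splice {T : Type} (c : R) (f g : R -> T) (t : R) : T :=
  if Rle_dec t c then f t else g t.

Lemma is_derive_splice (c : R) (f g f' g' : R -> R) :
  (forall t, is_derive f t (f' t)) -> (forall t, is_derive g t (g' t)) ->
  f c = g c -> f' c = g' c ->
  forall t, is_derive (splice c f g) t (splice c f' g' t).
Proof.
  intros Hf Hg Hfg Hfg' t.
  destruct (Rtotal_order t c) as [Ht | [Ht | Ht]].
  - apply is_derive_ext_loc with f.
    + assert (Hp : 0 < c - t) by lra.
      exists (mkposreal _ Hp); intros y Hy.
      unfold ball in Hy; simpl in Hy; unfold AbsRing_ball, abs, minus, plus, opp in Hy;
        simpl in Hy.
      apply Rabs_def2 in Hy; unfold splice; destruct (Rle_dec y c); [easy | lra].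
    + unfold splice; destruct (Rle_dec t c); [apply Hf | lra].
  - subst t. apply is_derive_Reals; intros eps He.
    assert (H1 := proj1 (is_derive_Reals _ _ _) (Hf c) eps He).
    assert (H2 := proj1 (is_derive_Reals _ _ _) (Hg c) eps He).
    destruct H1 as [d1 H1], H2 as [d2 H2].
    assert (Hd : 0 < Rmin d1 d2) by (apply Rmin_glb_lt; apply cond_pos).
    exists (mkposreal _ Hd); intros h Hh0 Hh; simpl in Hh.
    assert (Hh1 := Rlt_le_trans _ _ _ Hh (Rmin_l _ _)).
    assert (Hh2 := Rlt_le_trans _ _ _ Hh (Rmin_r _ _)).
    unfold splice; destruct (Rle_dec c c) as [_ | n]; [| lra].
    destruct (Rle_dec (c + h) c); [now apply H1 |].
    rewrite Hfg, Hfg'; now apply H2.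
  - apply is_derive_ext_loc with g.
    + assert (Hp : 0 < t - c) by lra.
      exists (mkposreal _ Hp); intros y Hy.
      unfold ball in Hy; simpl in Hy; unfold AbsRing_ball, abs, minus, plus, opp in Hy;
        simpl in Hy.
      apply Rabs_def2 in Hy; unfold splice; destruct (Rle_dec y c); [lra | easy].
    + unfold splice; destruct (Rle_dec t c); [lra | apply Hg].
Qed.

Lemma has_derivative_splice (c : R) (f g f' g' : R -> C) :
  has_derivative f f' -> has_derivative g g' -> f c = g c -> f' c = g' c ->
  has_derivative (splice c f g) (splice c f' g').
Proof.
  intros Hf Hg Hfg Hfg' t; split.
  - assert (H := is_derive_splice c (fun u => Re (f u)) (fun u => Re (g u))
      (fun u => Re (f' u)) (fun u => Re (g' u))
      (fun u => proj1 (Hf u)) (fun u => proj1 (Hg u))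
      (f_equal Re Hfg) (f_equal Re Hfg') t).
    replace (Re (splice c f' g' t)) with
      (splice c (fun u => Re (f' u)) (fun u => Re (g' u)) t)
      by (unfold splice; now destruct (Rle_dec t c)).
    refine (is_derive_ext _ _ _ _ _ H).
    intros u; unfold splice; now destruct (Rle_dec u c).
  - assert (H := is_derive_splice c (fun u => Im (f u)) (fun u => Im (g u))
      (fun u => Im (f' u)) (fun u => Im (g' u))
      (fun u => proj2 (Hf u)) (fun u => proj2 (Hg u))
      (f_equal Im Hfg) (f_equal Im Hfg') t).
    replace (Im (splice c f' g' t)) with
      (splice c (fun u => Im (f' u)) (fun u => Im (g' u)) t)
      by (unfold splice; now destruct (Rle_dec t c)).
    refine (is_derive_ext _ _ _ _ _ H).
    intros u; unfold splice; now destruct (Rle_dec u c).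
Qed.

Lemma has_derivative_shift (c : R) (f f' : R -> C) :
  has_derivative f f' ->
  has_derivative (fun t => f (t - c)) (fun t => f' (t - c)).
Proof.
  intros Hf t; destruct (Hf (t - c)) as [H1 H2]; split.
  - evar_last.
    + apply (is_derive_comp (fun u => Re (f u)) (fun t => t - c) t _ 1 H1).
      auto_derive; [easy | ring].
    + unfold scal; simpl; unfold mult; simpl; ring.
  - evar_last.
    + apply (is_derive_comp (fun u => Im (f u)) (fun t => t - c) t _ 1 H2).
      auto_derive; [easy | ring].
    + unfold scal; simpl; unfold mult; simpl; ring.
Qed.

(** Applied to the heading: this bound survives splicing, whereas a second derivative need not exist
    at a joint. *)
Definition lipschitz (k : R) (f : R -> C) : Prop :=
  forall s t, Cmod (f s - f t)%C <= k * Rabs (s - t).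

Lemma lipschitz_splice (k c : R) (f g : R -> C) :
  lipschitz k f -> lipschitz k g -> f c = g c -> lipschitz k (splice c f g).
Proof.
  intros Hf Hg Hc.
  assert (Hmix : forall s t, s <= c -> c < t ->
            Cmod (f s - g t)%C <= k * Rabs (s - t)).
  { intros s t Hs Ht.
    replace (f s - g t)%C with ((f s - f c) + (g c - g t))%C
      by (rewrite Hc; ring).
    eapply Rle_trans; [apply Cmod_triangle |].
    eapply Rle_trans; [apply Rplus_le_compat; [apply Hf | apply Hg] |].
    rewrite !Rabs_left1 by lra; lra. }
  intros s t; unfold splice.
  destruct (Rle_dec s c), (Rle_dec t c); try apply Hf; try apply Hg.
  - apply Hmix; lra.
  - rewrite <- Cmod_opp, Rabs_minus_sym.
    replace (- (g s - f t))%C with (f t - g s)%C by ring.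
    apply Hmix; lra.
Qed.

Lemma derivative_within_intro (D : R -> Prop) (f f' h : R -> C) (t : R) :
  has_derivative f f' -> D t -> (forall u, D u -> h u = f u) ->
  derivative_within D h t (f' t).
Proof.
  intros Hf Ht Hh; destruct (Hf t) as [H1 H2].
  assert (Hgen : forall (P : C -> R) (l : R),
            is_derive (fun u => P (f u)) t l ->
            D_in (fun u => P (h u)) (fun _ => l) D t).
  { intros P l Hl; apply is_derive_Reals in Hl.
    intros eps He; destruct (Hl eps He) as [d Hd].
    exists d; split; [apply cond_pos |].
    intros u [[Hu Hne] Hdist]; simpl in *; unfold Rdist in *.
    rewrite (Hh u Hu), (Hh t Ht).
    specialize (Hd (u - t)); replace (t + (u - t)) with u in Hd by ring.
    apply Hd; [lra | exact Hdist]. }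
  split; apply Hgen; assumption.
Qed.

Lemma continuous_within_intro (D : R -> Prop) (f f' h : R -> C) (t : R) :
  has_derivative f f' -> D t -> (forall u, D u -> h u = f u) ->
  continuous_within D h t.
Proof.
  intros Hf Ht Hh.
  destruct (derivative_within_intro D f f' h t Hf Ht Hh) as [H1 H2].
  split; [exact (cont_deriv _ _ _ _ H1) | exact (cont_deriv _ _ _ _ H2)].
Qed.

Lemma continuous_within_lipschitz (k : R) (D : R -> Prop) (f h : R -> C) (t : R) :
  lipschitz k f -> D t -> (forall u, D u -> h u = f u) ->
  continuous_within D h t.
Proof.
  intros Hf Ht Hh.
  assert (Hgen : forall (P : C -> R),
            (forall z w, Rabs (P z - P w) <= Cmod (z - w)%C) ->
            continue_in (fun u => P (h u)) D t).
  { intros P HP eps He.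
    assert (Hk : 0 < Rabs k + 1) by (generalize (Rabs_pos k); lra).
    exists (eps / (Rabs k + 1)); split; [now apply Rdiv_lt_0_compat |].
    intros u [[Hu _] Hdist]; simpl in *; unfold Rdist in *.
    rewrite (Hh u Hu), (Hh t Ht).
    eapply Rle_lt_trans; [apply HP |].
    eapply Rle_lt_trans; [apply Hf |].
    assert (H0 := Rabs_pos (u - t)).
    apply Rle_lt_trans with ((Rabs k + 1) * Rabs (u - t)).
    - apply Rmult_le_compat_r; [exact H0 | generalize (Rle_abs k); lra].
    - rewrite Rmult_comm; apply Rlt_div_r; assumption. }
  split; apply Hgen; intros [a b] [c d]; simpl.
  - eapply Rle_trans; [| apply Rmax_Cmod]; simpl.
    eapply Rle_trans; [| apply Rmax_l]; apply Rle_refl.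
  - eapply Rle_trans; [| apply Rmax_Cmod]; simpl.
    eapply Rle_trans; [| apply Rmax_r]; apply Rle_refl.
Qed.

(** Every point of a nondegenerate interval, endpoints included, is a limit point of it; one-sided
    derivatives are therefore unique. *)
Lemma nearby_in_interval (T t d : R) :
  0 < T -> 0 <= t <= T -> 0 < d ->
  exists u, 0 <= u <= T /\ u <> t /\ Rabs (u - t) < d.
Proof.
  intros HT Ht Hd.
  set (m := Rmin d T / 2).
  assert (Hm : 0 < Rmin d T) by (now apply Rmin_glb_lt).
  assert (Hmd := Rmin_l d T); assert (HmT := Rmin_r d T).
  destruct (Rle_dec t (T / 2)) as [Hle | Hgt].
  - exists (t + m); unfold m; repeat split; try lra.
    rewrite Rabs_right; lra.
  - exists (t - m); unfold m; repeat split; try lra.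
    rewrite Rabs_left; lra.
Qed.

Lemma derivative_within_unique (T t : R) (f : R -> C) (l m : C) :
  0 < T -> 0 <= t <= T ->
  derivative_within (interval 0 T) f t l ->
  derivative_within (interval 0 T) f t m -> l = m.
Proof.
  intros HT Ht [Hl1 Hl2] [Hm1 Hm2].
  assert (Hadh : adhDa (D_x (interval 0 T) t) t).
  { intros d Hd; destruct (nearby_in_interval T t d HT Ht Hd) as [u [H1 [H2 H3]]].
    exists u; split; [split; [exact H1 | now apply not_eq_sym] | exact H3]. }
  apply C_ext.
  - exact (single_limit _ _ _ _ _ Hadh Hl1 Hm1).
  - exact (single_limit _ _ _ _ _ Hadh Hl2 Hm2).
Qed.

Lemma Cmod_le_Rabs (z : C) : Cmod z <= Rabs (Re z) + Rabs (Im z).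
Proof.
  destruct z as [a b]; simpl.
  replace (a, b) with (RtoC a + RtoC b * Ci)%C by (apply C_ext; simpl; ring).
  eapply Rle_trans; [apply Cmod_triangle |].
  rewrite Cmod_mult, !Cmod_R, Cmod_Ci; lra.
Qed.

(** Difference quotients of a [k]-Lipschitz map have modulus at most [k], and [a] lies within any
    [eps] of one of them, each coordinate contributing [eps / 2]. *)
Lemma lipschitz_derivative_bound (k T t : R) (f h : R -> C) (a : C) :
  0 < T -> 0 <= t <= T -> lipschitz k f ->
  (forall u, 0 <= u <= T -> h u = f u) ->
  derivative_within (interval 0 T) h t a -> Cmod a <= k.
Proof.
  intros HT Ht Hf Hh [H1 H2].
  apply le_epsilon; intros eps He.
  assert (He2 : 0 < eps / 2) by lra.
  destruct (H1 _ He2) as [d1 [Hd1 K1]], (H2 _ He2) as [d2 [Hd2 K2]].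
  destruct (nearby_in_interval T t (Rmin d1 d2) HT Ht) as [u [Hu [Hne Hd]]].
  { now apply Rmin_glb_lt. }
  assert (HD : D_x (interval 0 T) t u) by (split; [exact Hu | now apply not_eq_sym]).
  specialize (K1 u (conj HD (Rlt_le_trans _ _ _ Hd (Rmin_l _ _)))).
  specialize (K2 u (conj HD (Rlt_le_trans _ _ _ Hd (Rmin_r _ _)))).
  simpl in K1, K2; unfold Rdist in K1, K2.
  rewrite (Hh u Hu), (Hh t Ht) in K1, K2.
  set (q := ((f u - f t) * / RtoC (u - t))%C).
  assert (Hut : u - t <> 0) by lra.
  assert (HutC : RtoC (u - t) <> 0%C) by (intros E; apply RtoC_inj in E; lra).
  assert (Hq : q = ((Re (f u) - Re (f t)) / (u - t), (Im (f u) - Im (f t)) / (u - t))).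
  { unfold q; rewrite <- RtoC_inv by exact Hut.
    destruct (f u), (f t); apply C_ext; simpl; unfold Rdiv; ring. }
  assert (Hqk : Cmod q <= k).
  { unfold q; rewrite Cmod_mult, Cmod_inv by exact HutC.
    rewrite Cmod_R; apply Rmult_le_reg_r with (Rabs (u - t)).
    - now apply Rabs_pos_lt.
    - rewrite Rmult_assoc, Rinv_l, Rmult_1_r by (now apply Rabs_no_R0); apply Hf. }
  replace a with (q + (a - q))%C by ring.
  eapply Rle_trans; [apply Cmod_triangle |].
  apply Rplus_le_compat; [exact Hqk |].
  eapply Rle_trans; [apply Cmod_le_Rabs |].
  rewrite Hq; destruct a as [x y]; simpl in *.
  rewrite Rabs_minus_sym in K1, K2; unfold Rminus in *; lra.
Qed.

Lemma has_derivative_ext (f g f' g' : R -> C) :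
  (forall t, f t = g t) -> (forall t, f' t = g' t) ->
  has_derivative f f' -> has_derivative g g'.
Proof.
  intros Hfg Hfg' Hf t; rewrite <- Hfg'; destruct (Hf t) as [H1 H2]; split.
  - apply (is_derive_ext (fun u => Re (f u))); [| exact H1]; intros u; now rewrite Hfg.
  - apply (is_derive_ext (fun u => Im (f u))); [| exact H2]; intros u; now rewrite Hfg.
Qed.

Lemma has_derivative_rotation (omega : R) (c z : C) :
  has_derivative (fun t => c + cis (omega * t) * z)%C
                 (fun t => RtoC omega * Ci * cis (omega * t) * z)%C.
Proof.
  intros t; destruct c as [c1 c2], z as [z1 z2]; simpl; split;
    auto_derive; trivial; ring.
Qed.

Lemma has_derivative_line (x v : C) :
  has_derivative (fun t => x + RtoC t * v)%C (fun _ => v).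
Proof.
  intros t; destruct x as [x1 x2], v as [v1 v2]; simpl; split;
    auto_derive; trivial; ring.
Qed.

Lemma has_derivative_const (v : C) : has_derivative (fun _ => v) (fun _ => RtoC 0).
Proof. intros t; simpl; split; apply @is_derive_const. Qed.

Lemma turn_sign_sq (a : turn) : turn_sign a * turn_sign a = 1.
Proof. destruct a; simpl; ring. Qed.

Lemma Rabs_turn_sign (a : turn) : Rabs (turn_sign a) = 1.
Proof. destruct a; simpl; [rewrite Rabs_left1 | rewrite Rabs_right]; lra. Qed.

(** * Oriented points along a word *)

Section Words.

Variable kappa : R.
Hypothesis hkappa : 0 < kappa.

Lemma advance_derivative (p : piece) (X : tangent_bundle) :
  has_derivative (fun t => base (advance kappa p t X))
                 (fun t => dir (advance kappa p t X)).
Proof.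
  destruct p as [a eta | d]; simpl.
  - refine (has_derivative_ext _ _ _ _ _ _ (has_derivative_rotation
      (turn_sign a * kappa) (center kappa a X) (base X - center kappa a X)%C)).
    + reflexivity.
    + intros t; unfold center.
      assert (Hk : kappa <> 0) by lra.
      destruct X as [[x1 x2] [v1 v2]], a; apply C_ext; simpl; field; exact Hk.
  - apply has_derivative_line.
Qed.

(** A vector in spite of the name: the acceleration along the piece. *)
Definition curvature (p : piece) (X : tangent_bundle) (t : R) : C :=
  match p with
  | Arc a _ => (RtoC (turn_sign a * kappa) * Ci * dir (advance kappa p t X))%C
  | Seg _ => RtoC 0
  end.

Lemma dir_derivative (p : piece) (X : tangent_bundle) :
  has_derivative (fun t => dir (advance kappa p t X)) (curvature p X).
Proof.
  destruct p as [a eta | d]; simpl.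
  - refine (has_derivative_ext _ _ _ _ _ _ (has_derivative_rotation
      (turn_sign a * kappa) 0%C (dir X))).
    + intros t; ring.
    + intros t; unfold curvature; simpl; ring.
  - apply has_derivative_const.
Qed.

Lemma curvature_derivative (p : piece) (X : tangent_bundle) :
  exists f, has_derivative (curvature p X) f.
Proof.
  destruct p as [a eta | d]; unfold curvature; simpl; eexists.
  - refine (has_derivative_ext _ _ _ _ _ _ (has_derivative_rotation
      (turn_sign a * kappa) 0%C (RtoC (turn_sign a * kappa) * Ci * dir X)%C)).
    + intros t; ring.
    + intros t; reflexivity.
  - apply has_derivative_const.
Qed.

Lemma advance_oriented (p : piece) (t : R) (X : tangent_bundle) :
  oriented_point X -> oriented_point (advance kappa p t X).
Proof.
  unfold oriented_point; destruct p as [a eta | d]; simpl; [| easy].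
  intros H; now rewrite Cmod_mult, Cmod_cis, H, Rmult_1_l.
Qed.

Lemma dir_lipschitz (p : piece) (X : tangent_bundle) :
  oriented_point X -> lipschitz kappa (fun t => dir (advance kappa p t X)).
Proof.
  unfold oriented_point; intros HX s t; destruct p as [a eta | d]; simpl.
  - replace (cis (turn_sign a * kappa * s) * dir X - cis (turn_sign a * kappa * t) * dir X)%C
      with ((cis (turn_sign a * kappa * s) - cis (turn_sign a * kappa * t)) * dir X)%C
      by ring.
    rewrite Cmod_mult, HX, Rmult_1_r.
    eapply Rle_trans; [apply lipschitz_cis |].
    replace (turn_sign a * kappa * s - turn_sign a * kappa * t)
      with (turn_sign a * (kappa * (s - t))) by ring.
    rewrite !Rabs_mult, Rabs_turn_sign, (Rabs_right kappa) by lra; lra.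
  - replace (dir X - dir X)%C with (RtoC 0) by ring.
    rewrite Cmod_0; generalize (Rabs_pos (s - t)); nra.
Qed.

Lemma advance_0 (p : piece) (X : tangent_bundle) : advance kappa p 0 X = X.
Proof.
  destruct X as [x v], p as [a eta | d]; simpl; unfold base, dir; simpl.
  - rewrite Rmult_0_r, cis_0; f_equal; ring.
  - f_equal; ring.
Qed.

(* Prolonging a word by a ray makes it C^1 on all of R, so that no one-sided
   derivatives are needed. *)
Fixpoint word_state (w : list piece) (X : tangent_bundle) (t : R)
  : tangent_bundle :=
  match w with
  | [] => advance kappa (Seg 0) t X
  | p :: w' =>
      splice (piece_length kappa p) (fun u => advance kappa p u X)
        (fun u => word_state w' (advance kappa p (piece_length kappa p) X)
                    (u - piece_length kappa p)) t
  end.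

Fixpoint word_end (w : list piece) (X : tangent_bundle) : tangent_bundle :=
  match w with
  | [] => X
  | p :: w' => word_end w' (advance kappa p (piece_length kappa p) X)
  end.

Definition nonneg_word (w : list piece) : Prop :=
  List.Forall (fun p => 0 <= measure p) w.

Lemma piece_length_ge0 (p : piece) : 0 <= measure p -> 0 <= piece_length kappa p.
Proof.
  destruct p; simpl; [| easy]; intros H; apply Rdiv_le_0_compat; assumption.
Qed.

Lemma word_length_ge0 (w : list piece) : nonneg_word w -> 0 <= word_length kappa w.
Proof.
  induction 1 as [| p w Hp _ IH]; simpl; [lra |].
  apply piece_length_ge0 in Hp; lra.
Qed.

Lemma word_state_0 (w : list piece) (X : tangent_bundle) :
  nonneg_word w -> word_state w X 0 = X.
Proof.
  intros Hw; destruct Hw as [| p w Hp Hw]; cbn [word_state].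
  - apply advance_0.
  - unfold splice; apply piece_length_ge0 in Hp.
    destruct (Rle_dec 0 _); [apply advance_0 | lra].
Qed.

Lemma word_state_trace (w : list piece) (X : tangent_bundle) (t : R) :
  t <= word_length kappa w -> nonneg_word w -> 0 <= t ->
  base (word_state w X t) = word_trace kappa w X t.
Proof.
  intros Ht Hw; revert X t Ht.
  induction Hw as [| p w Hp _ IH]; intros X t; cbn [word_state word_trace word_length].
  - intros H1 H2; replace t with 0 by lra; now rewrite advance_0.
  - unfold splice; intros H1 H2; destruct (Rle_dec t _); [easy |].
    apply IH; lra.
Qed.

Lemma word_state_end (w : list piece) (X : tangent_bundle) :
  nonneg_word w -> word_state w X (word_length kappa w) = word_end w X.
Proof.
  intros Hw; revert X.
  induction Hw as [| p w Hp Hw IH]; intros X; cbn [word_state word_end word_length].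
  - apply advance_0.
  - assert (H := word_length_ge0 w Hw); unfold splice.
    destruct (Rle_dec _ _) as [Hle |].
    + assert (H0 : word_length kappa w = 0) by lra.
      rewrite H0, Rplus_0_r, <- IH, H0; now rewrite word_state_0.
    + replace (_ + _ - _) with (word_length kappa w) by ring; apply IH.
Qed.

Lemma word_state_derivative (w : list piece) (X : tangent_bundle) :
  nonneg_word w ->
  has_derivative (fun t => base (word_state w X t)) (fun t => dir (word_state w X t)).
Proof.
  intros Hw; revert X.
  induction Hw as [| p w Hp Hw IH]; intros X; cbn [word_state].
  - apply advance_derivative.
  - set (l := piece_length kappa p); set (X' := advance kappa p l X).
    refine (has_derivative_ext _ _ _ _ _ _
      (has_derivative_splice l _ _ _ _ (advance_derivative p X)
         (has_derivative_shift l _ _ (IH X')) _ _)).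
    1, 2: intros t; unfold splice; now destruct (Rle_dec t l).
    1, 2: rewrite Rminus_diag, word_state_0 by assumption; reflexivity.
Qed.

Lemma word_state_lipschitz (w : list piece) (X : tangent_bundle) :
  nonneg_word w -> oriented_point X ->
  lipschitz kappa (fun t => dir (word_state w X t)).
Proof.
  intros Hw; revert X.
  induction Hw as [| p w Hp Hw IH]; intros X HX; cbn [word_state].
  - now apply dir_lipschitz.
  - set (l := piece_length kappa p); set (X' := advance kappa p l X).
    assert (H : lipschitz kappa (splice l (fun u => dir (advance kappa p u X))
                  (fun u => dir (word_state w X' (u - l))))).
    { apply lipschitz_splice.
      - now apply dir_lipschitz.
      - intros s t; replace (s - t) with ((s - l) - (t - l)) by ring.
        apply (IH X'); now apply advance_oriented.
      - rewrite Rminus_diag, word_state_0 by assumption; reflexivity. }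
    intros s t; specialize (H s t); unfold splice in *.
    now destruct (Rle_dec s l), (Rle_dec t l).
Qed.

Lemma word_state_oriented (w : list piece) (X : tangent_bundle) (t : R) :
  oriented_point X -> oriented_point (word_state w X t).
Proof.
  revert X t; induction w as [| p w IH]; intros X t HX; cbn [word_state].
  - now apply advance_oriented.
  - unfold splice; destruct (Rle_dec t _); [| apply IH]; now apply advance_oriented.
Qed.

(* The smooth branches are defined on all of R, so that one-sided derivatives
   only enter when passing to piecewise_C1. *)
Definition piecewise_smooth (a b : R) (f : R -> C) : Prop :=
  exists (n : nat) (tau : nat -> R),
    tau 0%nat = a /\ tau n = b /\
    forall i, (i < n)%nat ->
      tau i < tau (S i) /\
      exists h h' h'' : R -> C, has_derivative h h' /\ has_derivative h' h'' /\
        forall t, tau i <= t <= tau (S i) -> f t = h t.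

Lemma piecewise_smooth_C1 (a b : R) (f : R -> C) :
  piecewise_smooth a b f -> piecewise_C1 a b f.
Proof.
  intros (n & tau & H0 & Hn & H); exists n, tau; repeat split; auto.
  - now apply H.
  - destruct (H i H1) as [_ (h & h' & h'' & Hh & Hh' & Hf)].
    exists h'; intros t Ht; split.
    + now apply (derivative_within_intro _ h).
    + now apply (continuous_within_intro _ h' h'').
Qed.

Lemma piecewise_smooth_ext (a b : R) (f g : R -> C) :
  (forall t, a <= t <= b -> f t = g t) ->
  piecewise_smooth a b f -> piecewise_smooth a b g.
Proof.
  intros Hfg (n & tau & H0 & Hn & H); exists n, tau; repeat split; auto.
  - now apply H.
  - destruct (H i H1) as [_ (h & h' & h'' & Hh & Hh' & Hf)].
    exists h, h', h''; repeat split; try apply Hh; try apply Hh'.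
    intros t Ht; rewrite <- Hfg; [now apply Hf |].
    assert (Hmono : forall j k, (j <= k)%nat -> (k <= n)%nat -> tau j <= tau k).
    { intros j k Hjk; induction Hjk as [| k Hjk IH]; intros Hk; [lra |].
      specialize (IH ltac:(lia)); destruct (H k) as [Hlt _]; [lia | lra]. }
    assert (H2 := Hmono 0%nat i ltac:(lia) ltac:(lia)).
    assert (H3 := Hmono (S i) n ltac:(lia) ltac:(lia)); lra.
Qed.

Lemma word_state_piecewise (w : list piece) (X : tangent_bundle) :
  nonneg_word w ->
  piecewise_smooth 0 (word_length kappa w) (fun t => dir (word_state w X t)).
Proof.
  intros Hw; revert X.
  induction Hw as [| p w Hp Hw IH]; intros X; cbn [word_length].
  - exists 0%nat, (fun _ => 0); repeat split; lia.
  - set (l := piece_length kappa p); set (X' := advance kappa p l X).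
    assert (Hl : 0 <= l) by (now apply piece_length_ge0).
    assert (Hwl := word_length_ge0 w Hw).
    assert (Hafter : forall t, l <= t -> word_state (p :: w) X t = word_state w X' (t - l)).
    { intros t Ht; cbn [word_state]; fold l; fold X'; unfold splice.
      destruct (Rle_dec t l); [| easy].
      replace t with l by lra.
      now rewrite Rminus_diag, word_state_0. }
    (* The breakpoints must increase strictly, so a piece of length zero contributes no interval;
       otherwise 0 is put before the shifted breakpoints of the tail. *)
    destruct (Req_dec l 0) as [H0 | H0].
    + rewrite H0, Rplus_0_l.
      refine (piecewise_smooth_ext _ _ _ _ _ (IH X')).
      intros t Ht; rewrite Hafter by lra; now rewrite H0, Rminus_0_r.
    + destruct (IH X') as (n & tau & Ht0 & Htn & H).
      exists (S n), (fun i => match i with O => 0 | S j => l + tau j end).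
      split; [easy |]; split; [now rewrite Htn |].
      intros [| i] Hi.
      * rewrite Ht0; split; [lra |].
        destruct (curvature_derivative p X) as [h'' Hh''].
        exists (fun t => dir (advance kappa p t X)), (curvature p X), h''.
        split; [apply dir_derivative |]; split; [exact Hh'' |].
        intros t Ht; cbn [word_state]; fold l; unfold splice.
        destruct (Rle_dec t l); [easy | lra].
      * destruct (H i ltac:(lia)) as [Hlt (h & h' & h'' & Hh & Hh' & Hf)].
        split; [lra |].
        exists (fun t => h (t - l)), (fun t => h' (t - l)), (fun t => h'' (t - l)).
        split; [now apply has_derivative_shift |].
        split; [now apply has_derivative_shift |].
        assert (Hi0 : 0 <= tau i).
        { clear -H Ht0 Hi; assert (Hin : (i <= n)%nat) by lia; clear Hi.
          induction i as [| i IHi]; [lra |].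
          destruct (H i ltac:(lia)) as [Hlt _]; specialize (IHi ltac:(lia)); lra. }
        intros t Ht; rewrite Hafter by lra; apply Hf; lra.
Qed.

Definition word_path (w : list piece) (X : tangent_bundle) : path :=
  Path (word_length kappa w) (word_trace kappa w X).

(** Positive length is required because [Gamma] contains no path on a degenerate interval. *)
Lemma word_path_Gamma (w : list piece) (X : tangent_bundle) :
  nonneg_word w -> oriented_point X -> 0 < word_length kappa w ->
  Gamma kappa X (word_end w X) (word_path w X).
Proof.
  intros Hw HX HT; split; [simpl; lra |].
  exists (fun t => dir (word_state w X t)); simpl.
  assert (Htr : forall t, 0 <= t <= word_length kappa w ->
            word_trace kappa w X t = base (word_state w X t)).
  { intros t Ht; symmetry; apply word_state_trace; tauto. }
  repeat split.
  - now apply (derivative_within_intro _ _ _ _ _ (word_state_derivative w X Hw)).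
  - now apply (derivative_within_intro _ _ _ _ _ (word_state_derivative w X Hw)).
  - now apply (continuous_within_lipschitz kappa _ _ _ _ (word_state_lipschitz w X Hw HX)).
  - now apply (continuous_within_lipschitz kappa _ _ _ _ (word_state_lipschitz w X Hw HX)).
  - now apply piecewise_smooth_C1, word_state_piecewise.
  - intros t _; now apply word_state_oriented.
  - rewrite Htr by lra; now rewrite word_state_0.
  - now rewrite word_state_0.
  - rewrite Htr by lra; now rewrite word_state_end.
  - now rewrite word_state_end.
  - intros t a Ht.
    now apply (lipschitz_derivative_bound kappa (word_length kappa w) t _ _ a HT Ht
                 (word_state_lipschitz w X Hw HX)).
Qed.

Lemma Gamma_dom_end_gt0 (X Y : tangent_bundle) (g : path) :
  Gamma kappa X Y g -> 0 < dom_end g.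
Proof.
  intros (H0 & g1 & _ & _ & _ & _ & _ & _ & _ & Hb).
  destruct (Rle_lt_or_eq_dec _ _ H0) as [H | H]; [exact H |].
  (* On a degenerate interval every vector is a derivative. *)
  exfalso; assert (Hc : Cmod (RtoC (kappa + 1)) <= kappa).
  { apply (Hb 0); [lra |]; rewrite <- H.
    split; intros eps He; exists 1; split; try lra;
      intros u [[[Hu1 Hu2] Hne] _]; exfalso; apply Hne; lra. }
  rewrite Cmod_R, Rabs_right in Hc; lra.
Qed.

(** [Derive] is two-sided and agrees with the derivative within the interval at interior points; the
    integral sees only those, and the speed there is 1. *)
Lemma Gamma_path_length (X Y : tangent_bundle) (g : path) :
  Gamma kappa X Y g -> path_length g = dom_end g.
Proof.
  intros HG; assert (HT := Gamma_dom_end_gt0 _ _ _ HG).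
  destruct HG as (H0 & g1 & HC & _ & H1 & _).
  unfold path_length; rewrite (RInt_ext _ (fun _ => 1)).
  - rewrite RInt_const; unfold scal; simpl; unfold mult; simpl; ring.
  - rewrite Rmin_left, Rmax_right by lra; intros t Ht.
    destruct (HC t) as [[D1 D2] _]; [lra |].
    assert (Hgen : forall (P : C -> R) l,
              D_in (fun u => P (trace g u)) (fun _ => l) (interval 0 (dom_end g)) t ->
              Derive (fun u => P (trace g u)) t = l).
    { intros P l HD; apply is_derive_unique, is_derive_Reals.
      intros eps He; destruct (HD eps He) as [d [Hd K]].
      assert (Hm : 0 < Rmin d (Rmin t (dom_end g - t))).
      { repeat apply Rmin_glb_lt; lra. }
      exists (mkposreal _ Hm); simpl; intros h Hh0 Hh.
      assert (M1 := Rmin_l d (Rmin t (dom_end g - t))).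
      assert (M2 := Rmin_r d (Rmin t (dom_end g - t))).
      assert (M3 := Rmin_l t (dom_end g - t)).
      assert (M4 := Rmin_r t (dom_end g - t)).
      specialize (K (t + h)); simpl in K; unfold Rdist in K.
      replace (t + h - t) with h in K by ring; apply K.
      assert (Hh2 := Rabs_def2 _ _ Hh).
      split; [split; [split; lra | lra] | lra]. }
    rewrite (Hgen Re _ D1), (Hgen Im _ D2), <- (H1 t) by lra.
    now destruct (g1 t).
Qed.

(** [of_type] constrains positions only. The final heading is recovered as the derivative at the
    right endpoint, unique within a nondegenerate interval. *)
Lemma of_type_end (X Y : tangent_bundle) (g : path) (w : list piece) :
  Gamma kappa X Y g -> of_type kappa X w g -> word_end w X = Y.
Proof.
  intros HG (Hw & HT & Htr); assert (Hpos := Gamma_dom_end_gt0 _ _ _ HG).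
  destruct HG as (H0 & g1 & HC & _ & _ & _ & _ & HY & HdY & _).
  assert (Heq : forall t, 0 <= t <= dom_end g -> trace g t = base (word_state w X t)).
  { intros t Ht; rewrite Htr by exact Ht; symmetry; apply word_state_trace; tauto || lra. }
  rewrite <- word_state_end, <- HT by exact Hw.
  destruct Y as [y v]; simpl in *.
  destruct (word_state w X (dom_end g)) as [y' v'] eqn:E; f_equal.
  - rewrite <- HY, Heq, E by lra; reflexivity.
  - rewrite <- HdY.
    replace v' with (dir (word_state w X (dom_end g))) by (now rewrite E).
    apply (derivative_within_unique (dom_end g) (dom_end g) (trace g)); try lra.
    + apply (derivative_within_intro _ _ _ _ _ (word_state_derivative w X Hw));
        [split; lra | exact Heq].
    + apply HC; lra.
Qed.

End Words.

(** * Words as plane motions *)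

(* An orientation-preserving isometry z |-> fst m + snd m * z. *)
Definition motion : Type := (C * C)%type.

Definition motion_comp (m n : motion) : motion :=
  ((fst m + snd m * fst n)%C, (snd m * snd n)%C).

(* For kappa = 1, the motion taking (0, 1) to the oriented point where the
   piece started at (0, 1) ends. *)
Definition piece_motion (p : piece) : motion :=
  match p with
  | Arc a eta =>
      ((RtoC (turn_sign a) * Ci * (1 - cis (turn_sign a * eta)))%C,
       cis (turn_sign a * eta))
  | Seg d => (RtoC d, RtoC 1)
  end.

Fixpoint word_motion (w : list piece) : motion :=
  match w with
  | [] => (RtoC 0, RtoC 1)
  | p :: w' => motion_comp (piece_motion p) (word_motion w')
  end.

Fixpoint total (w : list piece) : R :=
  match w with
  | [] => 0
  | p :: w' => measure p + total w'
  end.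

Lemma motion_comp_assoc (m n p : motion) : motion_comp m (motion_comp n p) = motion_comp (motion_comp m n) p.
Proof. unfold motion_comp; simpl; f_equal; ring. Qed.

Lemma word_motion_app (w w' : list piece) :
  word_motion (w ++ w') = motion_comp (word_motion w) (word_motion w').
Proof.
  induction w as [| p w IH]; simpl.
  - destruct (word_motion w') as [z e]; unfold motion_comp; simpl; f_equal; ring.
  - now rewrite IH, motion_comp_assoc.
Qed.

Lemma total_app (w w' : list piece) : total (w ++ w') = total w + total w'.
Proof. induction w as [| p w IH]; simpl; [| rewrite IH]; ring. Qed.

Lemma nonneg_word_app (w w' : list piece) :
  nonneg_word (w ++ w') <-> nonneg_word w /\ nonneg_word w'.
Proof. apply Forall_app. Qed.

Definition rescale (k : R) (p : piece) : piece :=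
  match p with Arc a eta => Arc a eta | Seg d => Seg (k * d) end.

(** [Cconj (dir X)] inverts the unit vector [dir X]: this is [Y] read in the frame of [X], with
    [1 / kappa] as unit of length. *)
Definition relative_motion (kappa : R) (X Y : tangent_bundle) : motion :=
  ((RtoC kappa * (base Y - base X) * Cconj (dir X))%C, (dir Y * Cconj (dir X))%C).

Lemma oriented_conj (X : tangent_bundle) :
  oriented_point X -> (dir X * Cconj (dir X))%C = RtoC 1.
Proof.
  unfold oriented_point; intros H; rewrite <- Cmod2_conj, H.
  now rewrite pow1.
Qed.

(** * Reduction to curvature one *)

Section Scaling.

Variable kappa : R.
Hypothesis hkappa : 0 < kappa.

Lemma rescale_total (w : list piece) :
  total (map (rescale kappa) w) = kappa * word_length kappa w.
Proof.
  induction w as [| p w IH]; simpl; [ring |].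
  rewrite IH; destruct p; simpl; field; lra.
Qed.

Lemma rescale_nonneg (k : R) (w : list piece) :
  0 <= k -> nonneg_word w -> nonneg_word (map (rescale k) w).
Proof.
  intros Hk Hw; induction Hw as [| p w Hp _ IH]; constructor; [| exact IH].
  destruct p; simpl in *; [exact Hp | now apply Rmult_le_pos].
Qed.

Lemma rescale_inv (w : list piece) :
  map (rescale kappa) (map (rescale (/ kappa)) w) = w.
Proof.
  rewrite map_map; rewrite <- (map_id w) at 2; apply map_ext.
  intros [a eta | d]; simpl; f_equal; field; lra.
Qed.

Lemma word_end_motion (w : list piece) (X : tangent_bundle) :
  word_end kappa w X =
  ((base X + dir X * fst (word_motion (map (rescale kappa) w)) * RtoC (/ kappa))%C,
   (dir X * snd (word_motion (map (rescale kappa) w)))%C).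
Proof.
  revert X; induction w as [| p w IH]; intros [x v]; cbn [word_end map word_motion].
  - unfold base, dir; simpl; f_equal; ring.
  - rewrite IH; destruct (word_motion (map (rescale kappa) w)) as [z e].
    assert (Hk : RtoC kappa <> 0%C) by (intros E; apply RtoC_inj in E; lra).
    destruct p as [a eta | d]; unfold base, dir, motion_comp; simpl.
    + replace (turn_sign a * kappa * (eta / kappa)) with (turn_sign a * eta) by (field; lra).
      unfold center, base, dir; simpl.
      f_equal; [| ring].
      unfold Rdiv; rewrite RtoC_mult; ring.
    + f_equal; [| ring].
      rewrite RtoC_mult, RtoC_inv by lra; field; exact Hk.
Qed.

Lemma word_end_relative (w : list piece) (X Y : tangent_bundle) :
  oriented_point X ->
  word_end kappa w X = Y <->
  word_motion (map (rescale kappa) w) = relative_motion kappa X Y.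
Proof.
  intros HX; apply oriented_conj in HX; rewrite word_end_motion.
  assert (Hk : (RtoC kappa * RtoC (/ kappa))%C = 1%C)
    by (rewrite <- RtoC_mult; f_equal; field; lra).
  destruct (word_motion _) as [z e]; unfold relative_motion; simpl.
  set (k := RtoC kappa) in *; set (k' := RtoC (/ kappa)) in *.
  set (c := Cconj (dir X)) in *; set (v := dir X) in *; set (x := base X).
  split; intros H.
  - rewrite <- H; unfold base at 1, dir at 1; simpl; f_equal.
    + replace (k * (x + v * z * k' - x) * c)%C with ((k * k') * (v * c) * z)%C by ring.
      rewrite Hk, HX; ring.
    + replace (v * e * c)%C with ((v * c) * e)%C by ring; rewrite HX; ring.
  - injection H as Hz He; destruct Y as [y w']; unfold base, dir in Hz, He; simpl in Hz, He.
    rewrite Hz, He; f_equal.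
    + replace (x + v * (k * (y - x) * c) * k')%C
        with (x + (k * k') * (v * c) * (y - x))%C by ring.
      rewrite Hk, HX; ring.
    + replace (v * (w' * c))%C with ((v * c) * w')%C by ring; rewrite HX; ring.
Qed.

(** Together with [motion_of_path], the dictionary that lets the geometry be argued on words and
    sums of measures alone. *)
Lemma path_of_motion (w : list piece) (X Y : tangent_bundle) :
  oriented_point X -> nonneg_word w -> 0 < total w ->
  word_motion w = relative_motion kappa X Y ->
  exists g, Gamma kappa X Y g /\ of_type kappa X (map (rescale (/ kappa)) w) g /\
            path_length g = total w / kappa.
Proof.
  intros HX Hw HT Hm; set (w' := map (rescale (/ kappa)) w).
  assert (Hw' : nonneg_word w')
    by (apply rescale_nonneg; [now apply Rlt_le, Rinv_0_lt_compat | exact Hw]).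
  assert (HT' : total w = kappa * word_length kappa w')
    by (unfold w'; now rewrite <- rescale_total, rescale_inv).
  assert (Hpos : 0 < word_length kappa w') by (rewrite HT' in HT; nra).
  assert (Hend : word_end kappa w' X = Y)
    by (apply word_end_relative; [exact HX | unfold w'; now rewrite rescale_inv]).
  assert (HG : Gamma kappa X Y (word_path kappa w' X))
    by (rewrite <- Hend; now apply word_path_Gamma).
  exists (word_path kappa w' X).
  split; [exact HG |]; split; [repeat split; trivial |].
  rewrite (Gamma_path_length kappa hkappa X Y) by exact HG.
  rewrite HT'; simpl; field; lra.
Qed.

Lemma motion_of_path (w : list piece) (X Y : tangent_bundle) (g : path) :
  oriented_point X -> Gamma kappa X Y g -> of_type kappa X w g ->
  nonneg_word (map (rescale kappa) w) /\
  word_motion (map (rescale kappa) w) = relative_motion kappa X Y /\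
  path_length g = total (map (rescale kappa) w) / kappa /\
  0 < total (map (rescale kappa) w).
Proof.
  intros HX HG Hg.
  assert (HT := Gamma_dom_end_gt0 kappa hkappa X Y g HG).
  rewrite (Gamma_path_length kappa hkappa X Y g HG), rescale_total.
  repeat split.
  - apply rescale_nonneg; [lra | apply Hg].
  - apply word_end_relative; [exact HX |]; now apply (of_type_end kappa hkappa X Y g).
  - replace (dom_end g) with (word_length kappa w) by (symmetry; apply Hg); field; lra.
  - replace (word_length kappa w) with (dom_end g) by apply Hg; nra.
Qed.

End Scaling.

(** * Lengths of words with a prescribed motion *)

Definition reach (m : motion) (l : R) : Prop :=
  exists w, nonneg_word w /\ word_motion w = m /\ total w = l.

Lemma cis_turn_PI (a : turn) : cis (turn_sign a * PI) = (- RtoC 1)%C.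
Proof.
  destruct a; simpl; unfold cis.
  - replace (-1 * PI) with (- PI) by ring; rewrite cos_neg, sin_neg, cos_PI, sin_PI.
    apply C_ext; simpl; ring.
  - rewrite Rmult_1_l, cos_PI, sin_PI; apply C_ext; simpl; ring.
Qed.

(* A half turn reverses the heading, so the two segments cancel. *)
Lemma half_turn_stretch (a : turn) (h : R) :
  word_motion [Seg h; Arc a PI; Seg h] = word_motion [Arc a PI].
Proof.
  unfold word_motion, motion_comp, piece_motion; rewrite cis_turn_PI; cbn [fst snd].
  f_equal; ring.
Qed.

Lemma arc_split (a : turn) (s t : R) :
  word_motion [Arc a (s + t)] = word_motion [Arc a s; Arc a t].
Proof.
  unfold word_motion, motion_comp, piece_motion; rewrite Rmult_plus_distr_l, cis_add.
  cbn [fst snd]; f_equal; ring.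
Qed.

Lemma reach_ray (w1 w2 : list piece) (a : turn) (theta l : R) :
  nonneg_word (w1 ++ [Arc a theta] ++ w2) -> PI <= theta ->
  total (w1 ++ [Arc a theta] ++ w2) <= l ->
  reach (word_motion (w1 ++ [Arc a theta] ++ w2)) l.
Proof.
  intros Hw Hth Hl; set (h := (l - total (w1 ++ [Arc a theta] ++ w2)) / 2).
  assert (HP := PI_RGT_0).
  apply nonneg_word_app in Hw; destruct Hw as [H1 Hw].
  apply nonneg_word_app in Hw; destruct Hw as [_ H2].
  exists (w1 ++ ([Seg h; Arc a PI; Seg h] ++ [Arc a (theta - PI)]) ++ w2).
  split; [| split].
  - apply nonneg_word_app; split; [exact H1 |]; apply nonneg_word_app; split; [| exact H2].
    assert (0 <= h) by (unfold h; lra).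
    simpl; repeat apply Forall_cons; try apply Forall_nil; simpl; lra.
  - rewrite !word_motion_app, half_turn_stretch, <- word_motion_app.
    change ([Arc a PI] ++ [Arc a (theta - PI)]) with [Arc a PI; Arc a (theta - PI)].
    rewrite <- arc_split; now replace (PI + (theta - PI)) with theta by ring.
  - unfold h; rewrite !total_app; simpl; field.
Qed.

(** A full turn put in front has trivial motion and, having measure at least [PI], can itself be
    stretched to absorb any surplus. *)
Lemma reach_full_turn (m : motion) (l l' : R) :
  reach m l -> l + 2 * PI <= l' -> reach m l'.
Proof.
  intros (w & Hw & Hm & Hl) Hl'; assert (HP := PI_RGT_0).
  replace m with (word_motion ([] ++ [Arc Left (2 * PI)] ++ w)).
  - apply reach_ray; simpl; [constructor; simpl; [lra | exact Hw] | lra | lra].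
  - simpl; rewrite Hm; destruct m as [z e]; unfold motion_comp; simpl.
    replace (1 * (2 * PI)) with (2 * PI) by ring.
    replace (cis (2 * PI)) with (RtoC 1); [f_equal; ring |].
    unfold cis; now rewrite cos_2PI, sin_2PI.
Qed.

(** * From CSC to CCC *)

Lemma acos_le (x y : R) : 0 <= y <= PI -> cos y <= x -> acos x <= y.
Proof.
  intros Hy Hx; destruct (Rle_dec 1 x) as [H1 | H1].
  - unfold acos; destruct (Rle_dec x (-1)); [lra |].
    destruct (Rle_dec 1 x); lra.
  - assert (HB := COS_bound y); assert (Ha := acos_bound x).
    apply Rnot_lt_le; intros Hlt.
    assert (H := cos_decreasing_1 y (acos x) ltac:(lra) ltac:(lra) ltac:(lra) ltac:(lra) Hlt).
    rewrite cos_acos in H; lra.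
Qed.

(** True on the whole line because [acos] is constant outside [-1, 1]. Upper semicontinuity at [x]
    and at [- x] suffices, since [acos (- x) = PI - acos x]. *)
Lemma continuity_acos : continuity acos.
Proof.
  assert (Hup : forall x eps, 0 < eps ->
            exists d, 0 < d /\ forall x', Rabs (x' - x) < d -> acos x' < acos x + eps).
  { intros x eps He; assert (Ha := acos_bound x).
    destruct (Rlt_dec PI (acos x + eps)) as [Hbig | Hsmall].
    - exists 1; split; [lra |]; intros x' _; generalize (acos_bound x'); lra.
    - assert (Hx : cos (acos x + eps / 2) < x).
      { apply Rlt_le_trans with (cos (acos x)); [apply cos_decreasing_1; lra |].
        destruct (Rlt_dec x (-1)) as [H1 | H1].
        - exfalso; unfold acos in Hsmall.
          destruct (Rle_dec x (-1)); lra.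
        - destruct (Rle_dec x 1) as [H2 | H2]; [rewrite cos_acos; lra |].
          generalize (COS_bound (acos x)); lra. }
      exists (x - cos (acos x + eps / 2)); split; [lra |].
      intros x' Hx'; apply Rabs_def2 in Hx'.
      apply Rle_lt_trans with (acos x + eps / 2); [apply acos_le; lra | lra]. }
  intros x eps He.
  destruct (Hup x eps He) as [d1 [Hd1 H1]], (Hup (- x) eps He) as [d2 [Hd2 H2]].
  exists (Rmin d1 d2); split; [now apply Rmin_glb_lt |].
  intros x' [_ Hx']; simpl in *; unfold Rdist in *.
  specialize (H1 x' (Rlt_le_trans _ _ _ Hx' (Rmin_l _ _))).
  assert (H3 : Rabs (- x' - - x) < d2).
  { replace (- x' - - x) with (- (x' - x)) by ring; rewrite Rabs_Ropp.
    exact (Rlt_le_trans _ _ _ Hx' (Rmin_r _ _)). }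
  specialize (H2 _ H3); rewrite !acos_opp in H2.
  apply Rabs_def1; lra.
Qed.

Lemma continuity_pos (f : R -> R) (x : R) :
  continuity f -> 0 < f x -> exists d, 0 < d /\ forall y, Rabs (y - x) < d -> 0 < f y.
Proof.
  intros Hf Hx; destruct (Hf x (f x) Hx) as [d [Hd H]].
  exists d; split; [exact Hd |]; intros y Hy.
  destruct (Req_dec x y) as [<- | Hne]; [exact Hx |].
  assert (K : Rabs (f y - f x) < f x)
    by (apply H; split; [split; [exact I | exact Hne] | exact Hy]).
  apply Rabs_def2 in K; lra.
Qed.

(** Meant for the length of the segment, which must be nonnegative all the way to the point where it
    vanishes. The zero produced is the end of the initial stretch on which [f] is nonnegative; [f]
    may touch zero earlier. *)
Lemma first_zero (f : R -> R) (b : R) :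
  continuity f -> 0 <= f 0 -> 0 <= b ->
  (forall x, 0 <= x <= b -> 0 <= f x) \/
  exists x0, 0 <= x0 <= b /\ f x0 = 0 /\ forall x, 0 <= x <= x0 -> 0 <= f x.
Proof.
  intros Hf H0 Hb.
  destruct (classic (forall x, 0 <= x <= b -> 0 <= f x)) as [H | H]; [now left | right].
  apply not_all_ex_not in H; destruct H as [c H]; apply imply_to_and in H.
  destruct H as [Hc Hfc]; apply Rnot_le_lt in Hfc.
  set (E := fun x => 0 <= x <= c /\ forall y, 0 <= y <= x -> 0 <= f y).
  destruct (completeness E) as [m [Hm1 Hm2]].
  { exists c; intros x [Hx _]; lra. }
  { exists 0; split; [lra |]; intros y Hy; now replace y with 0 by lra. }
  assert (Hm0 : 0 <= m) by (apply Hm1; split; [lra |]; intros y Hy; now replace y with 0 by lra).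
  assert (Hmc : m <= c) by (apply Hm2; intros x [Hx _]; lra).
  assert (Hbelow : forall y, 0 <= y < m -> 0 <= f y).
  { intros y Hy; destruct (classic (exists x, E x /\ y < x)) as [[x [[_ Hx] Hyx]] | Hno].
    - apply Hx; lra.
    - exfalso; assert (m <= y); [| lra].
      apply Hm2; intros x Hx; apply Rnot_lt_le; intros Hlt; apply Hno; now exists x. }
  assert (Hge : 0 <= f m).
  { apply Rnot_lt_le; intros Hneg.
    destruct (continuity_pos (fun x => - f x) m) as [d [Hd Hcl]].
    { now apply continuity_opp. } { lra. }
    destruct (Req_dec m 0) as [E0 | E0]; [rewrite E0 in Hneg; lra |].
    set (y := Rmax 0 (m - d / 2)).
    assert (Hy1 := Rmax_l 0 (m - d / 2)); assert (Hy2 := Rmax_r 0 (m - d / 2)).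
    assert (Hy : y < m) by (apply Rmax_lub_lt; lra); fold y in Hy1, Hy2.
    assert (Hy3 := Hbelow y ltac:(lra)).
    assert (Hy4 := Hcl y ltac:(apply Rabs_def1; lra)); lra. }
  exists m; split; [lra |]; split.
  - destruct (Rle_lt_or_eq_dec _ _ Hge) as [Hpos | Heq]; [exfalso | easy].
    destruct (continuity_pos f m Hf Hpos) as [d [Hd Hcl]].
    assert (Hlt : m < c).
    { destruct (Rle_lt_or_eq_dec _ _ Hmc) as [Hl | Hl]; [exact Hl | rewrite Hl in Hpos; lra]. }
    set (x := Rmin c (m + d / 2)).
    assert (Hx1 := Rmin_l c (m + d / 2)); assert (Hx2 := Rmin_r c (m + d / 2)).
    assert (Hx : m < x) by (apply Rmin_glb_lt; lra); fold x in Hx1, Hx2.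
    assert (HE : E x).
    { split; [lra |]; intros y Hy.
      destruct (Rlt_dec y m) as [Hym | Hym]; [apply Hbelow; lra |].
      apply Rlt_le, Hcl, Rabs_def1; lra. }
    apply Hm1 in HE; lra.
  - intros x Hx; destruct (Req_dec x m) as [-> | Hne]; [exact Hge | apply Hbelow; lra].
Qed.

Lemma sin_mul_self (x : R) : sin x * sin x = 1 - cos x * cos x.
Proof. generalize (sin2_cos2 x); unfold Rsqr; lra. Qed.

Lemma cis_turn (a : turn) (x : R) : cis (turn_sign a * x) = (cos x, turn_sign a * sin x).
Proof.
  unfold cis; destruct a; simpl; rewrite ?Rmult_1_l; [| easy].
  replace (-1 * x) with (- x) by ring; rewrite cos_neg, sin_neg; f_equal; ring.
Qed.

Lemma turn_sign_opposite (a : turn) : turn_sign (opposite a) = - turn_sign a.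
Proof. destruct a; simpl; ring. Qed.

(** * Rolling one circle around the other *)

Definition translation (x y : R) : motion := ((x, y), RtoC 1).

(** The counter-turn rolls the circle of turn [a] around the opposite circle at the start, their
    centers staying at distance 2. In the frame of the segment, the vector between the centers
    passes from twice [(sin eta, cos eta)] to twice [(sin p, cos p)], up to the sign of the turn in
    the second coordinate, while the net turn remains [eta]. *)
Lemma roll_start (a : turn) (eta p : R) :
  word_motion [Arc (opposite a) (p - eta); Arc a p] =
  motion_comp (word_motion [Arc a eta])
    (translation (2 * (sin p - sin eta)) (turn_sign a * (2 * (cos p - cos eta)))).
Proof.
  (* The first occurrence is spared so that the counter-turn itself becomes the free variable
     [s]. *)
  replace eta with (p - (p - eta)) at 2 3 4 by ring; generalize (p - eta); intros s.
  assert (Hs := sin_mul_self s); assert (Hv := sin_mul_self p).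
  assert (Ha := turn_sign_sq a).
  unfold word_motion, motion_comp, piece_motion, translation; cbn [fst snd].
  rewrite !cis_turn, turn_sign_opposite, cos_minus, sin_minus.
  f_equal; apply C_ext; simpl; ring [Hs Hv Ha].
Qed.

(** The counterpart of [roll_start] at the other end of the segment: same advance, opposite lateral
    displacement. Equal changes of the two cosines therefore cancel. *)
Lemma roll_end (a : turn) (eta q : R) :
  word_motion [Arc a q; Arc (opposite a) (q - eta)] =
  motion_comp (translation (2 * (sin q - sin eta)) (turn_sign a * (- (2 * (cos q - cos eta)))))
    (word_motion [Arc a eta]).
Proof.
  replace eta with (q - (q - eta)) at 2 3 4 by ring; generalize (q - eta); intros s.
  assert (Hs := sin_mul_self s); assert (Hv := sin_mul_self q).
  assert (Ha := turn_sign_sq a).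
  unfold word_motion, motion_comp, piece_motion, translation; cbn [fst snd].
  rewrite !cis_turn, turn_sign_opposite, cos_minus, sin_minus.
  f_equal; apply C_ext; simpl; ring [Hs Hv Ha].
Qed.

Lemma translation_add (x y x' y' : R) :
  motion_comp (translation x y) (translation x' y') = translation (x + x') (y + y').
Proof. unfold motion_comp, translation; simpl; f_equal; apply C_ext; simpl; ring. Qed.

(** The advances of the two rollings are taken off the segment. They can be negative, so its length
    is not monotone in [p] and [q]. *)
Definition rolled (a : turn) (eta d xi p q : R) : list piece :=
  [Arc (opposite a) (p - eta); Arc a p;
   Seg (d - 2 * (sin p - sin eta) - 2 * (sin q - sin xi));
   Arc a q; Arc (opposite a) (q - xi)].

(* The heading of the segment is kept; both arcs of turn a are prolonged after
   a counter-turn, and the two lateral displacements cancel. *)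
Lemma rolled_motion (a : turn) (eta d xi p q : R) :
  cos p - cos eta = cos q - cos xi ->
  word_motion (rolled a eta d xi p q) = word_motion [Arc a eta; Seg d; Arc a xi].
Proof.
  intros H; unfold rolled.
  set (d' := d - 2 * (sin p - sin eta) - 2 * (sin q - sin xi)).
  change (word_motion ([Arc (opposite a) (p - eta); Arc a p] ++ [Seg d'] ++
            [Arc a q; Arc (opposite a) (q - xi)]) =
          word_motion ([Arc a eta] ++ [Seg d] ++ [Arc a xi])).
  rewrite !word_motion_app, roll_start, roll_end.
  assert (Hseg : forall r, word_motion [Seg r] = translation r 0).
  { intros r; unfold word_motion, motion_comp, translation; simpl.
    f_equal; apply C_ext; simpl; ring. }
  rewrite !Hseg, <- motion_comp_assoc; f_equal.
  rewrite !motion_comp_assoc, !translation_add; f_equal.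
  unfold d'; rewrite H; f_equal; ring.
Qed.

Lemma total_rolled (a : turn) (eta d xi p q : R) :
  total (rolled a eta d xi p q) =
  d - eta - xi + 2 * p + 2 * q - 2 * (sin p - sin eta) - 2 * (sin q - sin xi).
Proof. unfold rolled; simpl; ring. Qed.

(** [alpha] and [beta] are counter-turns already present, which the deformation merely prolongs;
    they let one statement serve all four CSC types. *)
Lemma reach_CSC_to_CCC (a : turn) (alpha eta d xi beta l : R) :
  0 <= alpha -> 0 <= eta < PI -> 0 <= d -> 0 <= xi < PI -> 0 <= beta ->
  alpha + (eta + d + xi) + beta <= l ->
  let w := [Arc (opposite a) alpha] ++ [Arc a eta; Seg d; Arc a xi]
             ++ [Arc (opposite a) beta] in
  reach (word_motion w) l \/
  exists p q, eta <= p < PI /\ xi <= q < PI /\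
    alpha + (2 * p - eta) + (2 * q - xi) + beta < l /\
    word_motion [Arc (opposite a) (alpha + (p - eta)); Arc a (p + q);
                 Arc (opposite a) (q - xi + beta)] = word_motion w.
Proof.
  intros Ha Heta Hd Hxi Hb Hl w; assert (HPI := PI_RGT_0).
  (* The parameter [x] is the common decrease of the two cosines, so the lateral displacements
     cancel for every [x]. *)
  set (p := fun x => acos (cos eta - x)); set (q := fun x => acos (cos xi - x)).
  set (D := fun x => d - 2 * (sin (p x) - sin eta) - 2 * (sin (q x) - sin xi)).
  set (W := fun x => [Arc (opposite a) alpha] ++ rolled a eta d xi (p x) (q x)
                       ++ [Arc (opposite a) beta]).
  assert (Hacos : forall c, continuity (fun x => acos (c - x))).
  { intros c; apply (continuity_comp (fun x => c - x) acos); [| apply continuity_acos].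
    apply continuity_minus; [now apply continuity_const | apply derivable_continuous, derivable_id]. }
  assert (Hp := Hacos (cos eta)); assert (Hq := Hacos (cos xi)); fold p in Hp; fold q in Hq.
  assert (Hsin : forall f, continuity f -> continuity (fun x => sin (f x))).
  { intros f Hf; apply (continuity_comp f sin); [exact Hf | apply continuity_sin]. }
  assert (Hcst : forall c, continuity (fun _ : R => c)) by (intros c; now apply continuity_const).
  assert (HD : continuity D).
  { apply continuity_minus; [apply continuity_minus; [apply Hcst |] |];
      apply continuity_mult; try apply Hcst; apply continuity_minus; try apply Hcst; now apply Hsin. }
  assert (Hce : -1 < cos eta <= 1).
  { split; [| apply COS_bound].
    rewrite <- cos_PI; apply cos_decreasing_1; lra. }
  assert (Hcx : -1 < cos xi <= 1).
  { split; [| apply COS_bound].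
    rewrite <- cos_PI; apply cos_decreasing_1; lra. }
  (* At [x = b] the smaller of the two cosines has come down to -1: that arc is a half turn. *)
  set (b := 1 + Rmin (cos eta) (cos xi)).
  assert (Hb1 := Rmin_l (cos eta) (cos xi)); assert (Hb2 := Rmin_r (cos eta) (cos xi)).
  assert (Hbpos : 0 < b).
  { unfold b; assert (-1 < Rmin (cos eta) (cos xi)) by (apply Rmin_glb_lt; lra); lra. }
  assert (Hcp : forall x, 0 <= x <= b -> cos (p x) = cos eta - x)
    by (intros x Hx; apply cos_acos; unfold b in Hx; lra).
  assert (Hcq : forall x, 0 <= x <= b -> cos (q x) = cos xi - x)
    by (intros x Hx; apply cos_acos; unfold b in Hx; lra).
  assert (Hpb : forall x, 0 <= x <= b -> eta <= p x <= PI).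
  { intros x Hx; assert (B := acos_bound (cos eta - x)); fold (p x) in B.
    split; [| lra]; apply Rnot_lt_le; intros Hlt.
    assert (K := cos_decreasing_1 (p x) eta ltac:(lra) ltac:(lra) ltac:(lra) ltac:(lra) Hlt).
    rewrite Hcp in K; lra. }
  assert (Hqb : forall x, 0 <= x <= b -> xi <= q x <= PI).
  { intros x Hx; assert (B := acos_bound (cos xi - x)); fold (q x) in B.
    split; [| lra]; apply Rnot_lt_le; intros Hlt.
    assert (K := cos_decreasing_1 (q x) xi ltac:(lra) ltac:(lra) ltac:(lra) ltac:(lra) Hlt).
    rewrite Hcq in K; lra. }
  assert (HW : forall x, 0 <= x <= b -> word_motion (W x) = word_motion w).
  { intros x Hx; unfold W, w; rewrite !word_motion_app, rolled_motion; [easy |].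
    rewrite Hcp, Hcq by exact Hx; ring. }
  assert (HWnn : forall x, 0 <= x <= b -> 0 <= D x -> nonneg_word (W x)).
  { intros x Hx Hx'; specialize (Hpb x Hx); specialize (Hqb x Hx); unfold D in Hx'.
    simpl; repeat apply Forall_cons; try apply Forall_nil; simpl; lra. }
  assert (Htot : forall x, total (W x) = alpha + (2 * p x - eta) + D x + (2 * q x - xi) + beta).
  { intros x; unfold W, D; rewrite !total_app, total_rolled; simpl; ring. }
  assert (Hp0 : p 0 = eta) by (unfold p; rewrite Rminus_0_r, acos_cos; lra).
  assert (Hq0 : q 0 = xi) by (unfold q; rewrite Rminus_0_r, acos_cos; lra).
  assert (HD0 : D 0 = d) by (unfold D; rewrite Hp0, Hq0; ring).
  (* The length varies continuously from that of [w], so a value [l] overtaken on the way is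
     attained. *)
  assert (Hinter : forall x0, 0 <= x0 <= b -> (forall x, 0 <= x <= x0 -> 0 <= D x) ->
            l <= total (W x0) -> reach (word_motion w) l).
  { intros x0 Hx0 Hpos Hlx.
    destruct (IVT_cor (fun x => total (W x) - l) 0 x0) as [x [Hx Hxl]].
    - apply continuity_minus; [| apply Hcst].
      intros x; apply (continuity_pt_ext (fun x => alpha + (2 * p x - eta) + D x + (2 * q x - xi) + beta)).
      + intros y; now rewrite Htot.
      + revert x; change (continuity (fun x => alpha + (2 * p x - eta) + D x + (2 * q x - xi) + beta)).
        repeat first [apply Hcst | exact HD | exact Hp | exact Hq
                     | apply continuity_plus | apply continuity_minus | apply continuity_mult].
    - lra.
    - rewrite (Htot 0), Hp0, Hq0, HD0; nra.
    - exists (W x); split; [apply HWnn; [lra | apply Hpos; lra] |].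
      split; [apply HW; lra | lra]. }
  (* If [l] has not been overtaken when an arc reaches [PI], that arc is stretched up to [l]. *)
  assert (Hend : forall x0, 0 <= x0 <= b -> (forall x, 0 <= x <= x0 -> 0 <= D x) ->
            PI <= p x0 \/ PI <= q x0 -> reach (word_motion w) l).
  { intros x0 Hx0 Hpos Hpq.
    destruct (Rle_dec l (total (W x0))) as [Hle | Hgt]; [now apply (Hinter x0) |].
    rewrite <- (HW x0) by exact Hx0.
    assert (Hnn := HWnn x0 Hx0 (Hpos x0 ltac:(lra))).
    destruct Hpq as [HP | HP].
    - exact (reach_ray [Arc (opposite a) alpha; Arc (opposite a) (p x0 - eta)] _ a (p x0) l
               Hnn HP ltac:(apply Rlt_le, Rnot_le_lt, Hgt)).
    - exact (reach_ray [Arc (opposite a) alpha; Arc (opposite a) (p x0 - eta); Arc a (p x0); _]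
               _ a (q x0) l Hnn HP ltac:(apply Rlt_le, Rnot_le_lt, Hgt)). }
  destruct (first_zero D b HD) as [Hpos | (x0 & Hx0 & Hz & Hpos)]; try lra.
  - left; apply (Hend b); [lra | exact Hpos |].
    destruct (Rle_dec (cos eta) (cos xi)) as [Hle | Hle].
    + left; rewrite <- (acos_cos PI) by lra; right; unfold p; f_equal.
      unfold b; rewrite Rmin_left, cos_PI by lra; ring.
    + right; rewrite <- (acos_cos PI) by lra; right; unfold q; f_equal.
      unfold b; rewrite Rmin_right, cos_PI by lra; ring.
  - destruct (Rle_dec PI (p x0)) as [H1 | H1]; [left; apply (Hend x0); auto |].
    destruct (Rle_dec PI (q x0)) as [H2 | H2]; [left; apply (Hend x0); auto |].
    destruct (Rle_dec l (total (W x0))) as [Hle | Hgt]; [left; now apply (Hinter x0) |].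
    right; exists (p x0), (q x0).
    assert (P1 := Hpb x0 Hx0); assert (Q1 := Hqb x0 Hx0).
    split; [lra |]; split; [lra |].
    split; [rewrite Htot, Hz in Hgt; lra |].
    (* The segment is now null, so the two arcs of turn [a] merge into the middle arc, and each
       counter-turn merges with [alpha] or [beta]. *)
    rewrite <- (HW x0 Hx0); unfold W, rolled; fold (D x0); rewrite Hz.
    change (word_motion ([Arc (opposite a) (alpha + (p x0 - eta))] ++ [Arc a (p x0 + q x0)] ++
              [Arc (opposite a) (q x0 - xi + beta)]) =
            word_motion ([Arc (opposite a) alpha; Arc (opposite a) (p x0 - eta)] ++
              ([Arc a (p x0)] ++ [Seg 0] ++ [Arc a (q x0)]) ++
              [Arc (opposite a) (q x0 - xi); Arc (opposite a) beta])).
    assert (Hseg : forall m, motion_comp (word_motion [Seg 0]) m = m).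
    { intros [z e]; unfold word_motion, motion_comp; simpl; f_equal; ring. }
    rewrite !word_motion_app, Hseg, <- !arc_split, (arc_split a (p x0)).
    change [Arc a (p x0); Arc a (q x0)] with ([Arc a (p x0)] ++ [Arc a (q x0)]).
    now rewrite !word_motion_app.
Qed.

(** * CSC paths with short arcs *)

Definition CSC (a : turn) (eta d : R) (b : turn) (xi : R) : list piece :=
  [Arc a eta; Seg d; Arc b xi].

Lemma CSC_same_motion (a : turn) (eta d xi : R) :
  word_motion (CSC a eta d a xi) =
  ((sin (eta + xi) + d * cos eta, turn_sign a * (1 - cos (eta + xi) + d * sin eta)),
   (cos (eta + xi), turn_sign a * sin (eta + xi))).
Proof.
  assert (Ha := turn_sign_sq a).
  unfold CSC, word_motion, motion_comp, piece_motion; cbn [fst snd].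
  rewrite !cis_turn, cos_plus, sin_plus.
  f_equal; apply C_ext; simpl; ring [Ha].
Qed.

Lemma CSC_opposite_motion (a : turn) (eta d xi : R) :
  word_motion (CSC a eta d (opposite a) xi) =
  ((d * cos eta + 2 * sin eta - sin (eta - xi),
    turn_sign a * (1 + d * sin eta - 2 * cos eta + cos (eta - xi))),
   (cos (eta - xi), turn_sign a * sin (eta - xi))).
Proof.
  assert (Ha := turn_sign_sq a).
  unfold CSC, word_motion, motion_comp, piece_motion; cbn [fst snd].
  rewrite !cis_turn, turn_sign_opposite, cos_minus, sin_minus.
  f_equal; apply C_ext; simpl; ring [Ha].
Qed.

(** Traversing a word backwards exchanges left and right, and a reflection restores the turns: the
    outer arcs are swapped, and the new motion depends only on the old one. *)
Lemma CSC_reverse_motion (a b : turn) (eta d xi : R) :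
  word_motion (CSC b xi d a eta) =
  ((snd (word_motion (CSC a eta d b xi)) * Cconj (fst (word_motion (CSC a eta d b xi))))%C,
   snd (word_motion (CSC a eta d b xi))).
Proof.
  assert (Ha := turn_sign_sq a); assert (Hb := turn_sign_sq b).
  assert (He := sin_mul_self eta); assert (Hx := sin_mul_self xi).
  unfold CSC, word_motion, motion_comp, piece_motion; cbn [fst snd].
  rewrite !cis_turn.
  f_equal; apply C_ext; simpl; ring [Ha Hb He Hx].
Qed.

Lemma angle_unique (x y : R) :
  cos x = cos y -> sin x = sin y -> exists k : Z, x = y + 2 * PI * IZR k.
Proof.
  intros Hc Hs; assert (H := sin_mul_self y).
  destruct (sin_eq_0_0 ((x - y) / 2)) as [k Hk].
  - assert (Hcos : cos (2 * ((x - y) / 2)) = 1).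
    { replace (2 * ((x - y) / 2)) with (x - y) by field.
      rewrite cos_minus, Hc, Hs; lra. }
    rewrite cos_2a_sin in Hcos; nra.
  - exists k; lra.
Qed.

Lemma turns_between (k m n : Z) :
  2 * PI * IZR m < 2 * PI * IZR k < 2 * PI * IZR n -> (m < k < n)%Z.
Proof.
  assert (HP := PI_RGT_0); intros [H1 H2]; split; apply lt_IZR; nra.
Qed.

Lemma turn_sign_cancel (a : turn) (x y : R) :
  turn_sign a * x = turn_sign a * y -> x = y.
Proof. destruct a; simpl; lra. Qed.

Lemma turn_sign_cancel_opposite (a : turn) (x y : R) :
  turn_sign a * x = turn_sign (opposite a) * y -> x = - y.
Proof. destruct a; simpl; lra. Qed.

(** The distance between the centers of the outer circles is [d] for equal turns, and its square is
    [d * d + 4] for opposite turns, so [d] is determined. For equal turns the final heading is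
    [eta + xi]; for opposite turns it is [eta - xi], and the vector between the centers gives [eta]
    as well. *)
Lemma CSC_length_mod_2PI (a b : turn) (eta d xi eta' d' xi' : R) :
  0 <= d -> 0 <= d' ->
  word_motion (CSC a eta d b xi) = word_motion (CSC a eta' d' b xi') ->
  d = d' /\ exists k : Z, eta + xi = eta' + xi' + 2 * PI * IZR k.
Proof.
  intros Hd Hd' H.
  assert (Hab : b = a \/ b = opposite a) by (destruct a, b; auto).
  destruct Hab as [-> | ->].
  - rewrite !CSC_same_motion in H; injection H as Hx Hy Hc Hs.
    apply turn_sign_cancel in Hy, Hs.
    assert (Hdd : d = d').
    { apply Rsqr_inj; trivial; unfold Rsqr.
      assert (Hx' : d * cos eta = d' * cos eta') by lra.
      assert (Hy' : d * sin eta = d' * sin eta') by lra.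
      assert (E := sin_mul_self eta); assert (E' := sin_mul_self eta').
      replace (d * d) with ((d * cos eta) * (d * cos eta) + (d * sin eta) * (d * sin eta))
        by ring [E].
      rewrite Hx', Hy'; ring [E']. }
    split; [exact Hdd | now apply angle_unique].
  - rewrite !CSC_opposite_motion in H; injection H as Hx Hy Hc Hs.
    apply turn_sign_cancel in Hy, Hs.
    set (x := d * cos eta + 2 * sin eta); set (y := d * sin eta - 2 * cos eta).
    assert (Hx' : x = d' * cos eta' + 2 * sin eta') by (unfold x; lra).
    assert (Hy' : y = d' * sin eta' - 2 * cos eta') by (unfold y; lra).
    assert (E := sin_mul_self eta); assert (E' := sin_mul_self eta').
    assert (Hdd : d = d').
    { apply Rsqr_inj; trivial; unfold Rsqr.
      apply Rplus_eq_reg_r with 4.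
      replace (d * d + 4) with (x * x + y * y) by (unfold x, y; ring [E]).
      rewrite Hx', Hy'; ring [E']. }
    split; [exact Hdd |]; subst d'.
    assert (Hd4 : 0 < d * d + 4) by nra.
    (* [x] and [y] are linear in [cos eta] and [sin eta], with determinant [d * d + 4]. *)
    destruct (angle_unique eta eta') as [k Hk].
    + apply Rmult_eq_reg_l with (d * d + 4); [| lra].
      transitivity (d * x - 2 * y); [unfold x, y; ring |]; rewrite Hx', Hy'; ring.
    + apply Rmult_eq_reg_l with (d * d + 4); [| lra].
      transitivity (d * y + 2 * x); [unfold x, y; ring |]; rewrite Hx', Hy'; ring.
    + destruct (angle_unique _ _ Hc Hs) as [m Hm].
      (* Because [eta + xi = 2 * eta - (eta - xi)]. *)
      exists (k + (k - m))%Z; rewrite plus_IZR, minus_IZR; lra.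
Qed.

(** [beta] is the angle between the two segments. [K1] and [K2] are the coordinates, along and
    across the second segment, of the vector joining the centers of turn [a] at start and end. For
    [d > 0] they place [beta] between 0 and [PI / 2], and the headings give [xi + xi' = beta]; this
    forces [xi' = 0], then [beta = 0]. *)
Lemma CSC_unique_LSL_LSR (a : turn) (eta d xi eta' d' xi' : R) :
  0 <= eta < PI -> 0 <= xi < PI -> 0 <= d ->
  0 <= eta' < PI -> 0 <= xi' < PI -> 0 <= d' ->
  word_motion (CSC a eta d a xi) = word_motion (CSC a eta' d' (opposite a) xi') ->
  eta + d + xi = eta' + d' + xi'.
Proof.
  intros He Hx Hd He' Hx' Hd' H; assert (HP := PI_RGT_0).
  rewrite CSC_same_motion, CSC_opposite_motion in H; injection H as E1 E2 Ec Es.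
  apply turn_sign_cancel in E2, Es.
  destruct (angle_unique _ _ Ec Es) as [k Hk].
  rewrite Es in E1; rewrite Ec in E2.
  set (beta := eta' - eta).
  assert (P' := sin_mul_self eta').
  assert (K1 : d * cos beta = d' + 2 * sin xi').
  { unfold beta; rewrite cos_minus.
    transitivity (cos eta' * (d * cos eta) + sin eta' * (d * sin eta)); [ring |].
    replace (d * cos eta) with (d' * cos eta' + 2 * sin eta' - 2 * sin (eta' - xi')) by lra.
    replace (d * sin eta) with (d' * sin eta' - 2 * cos eta' + 2 * cos (eta' - xi')) by lra.
    rewrite sin_minus, cos_minus; ring [P']. }
  assert (K2 : d * sin beta = 2 * (1 - cos xi')).
  { unfold beta; rewrite sin_minus.
    transitivity (sin eta' * (d * cos eta) - cos eta' * (d * sin eta)); [ring |].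
    replace (d * cos eta) with (d' * cos eta' + 2 * sin eta' - 2 * sin (eta' - xi')) by lra.
    replace (d * sin eta) with (d' * sin eta' - 2 * cos eta' + 2 * cos (eta' - xi')) by lra.
    rewrite sin_minus, cos_minus; ring [P']. }
  assert (Hsx : 0 <= sin xi') by (apply sin_ge_0; lra).
  assert (Hcx := COS_bound xi').
  assert (Hcx1 : 0 < xi' -> cos xi' < 1)
    by (intros H0; rewrite <- cos_0; apply cos_decreasing_1; lra).
  destruct (Req_dec d 0) as [Hd0 | Hd0].
  - assert (Hxi0 : xi' = 0).
    { destruct (Rle_lt_or_eq_dec 0 xi' ltac:(lra)) as [H0 | H0]; [| easy].
      specialize (Hcx1 H0); rewrite Hd0 in K2; lra. }
    rewrite Hd0, Hxi0, sin_0 in K1.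
    destruct (turns_between k (-1) 1) as [k1 k2]; [simpl; lra |].
    replace k with 0%Z in Hk by lia; lra.
  - assert (Hsb : 0 <= sin beta) by nra.
    assert (Hcb : 0 <= cos beta) by nra.
    assert (Hb0 : 0 <= beta).
    { apply Rnot_lt_le; intros Hlt; assert (sin beta < 0); [| lra].
      apply sin_lt_0_var; unfold beta in *; lra. }
    assert (Hb1 : beta <= PI / 2).
    { apply Rnot_lt_le; intros Hlt; assert (cos beta < 0); [| lra].
      apply cos_lt_0; unfold beta in *; lra. }
    assert (Hsum : xi + xi' = beta).
    { destruct (turns_between k (-1) 1) as [k1 k2]; [unfold beta in *; simpl; lra |].
      replace k with 0%Z in Hk by lia; unfold beta; lra. }
    assert (Hxi0 : xi' = 0).
    { destruct (Rle_lt_or_eq_dec 0 xi' ltac:(lra)) as [H0 | H0]; [exfalso | easy].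
      assert (Hlt : cos beta < cos (beta - xi')) by (apply cos_decreasing_1; lra).
      rewrite cos_minus in Hlt.
      (* Eliminating [d] between [K1] and [K2] and dropping [d' >= 0] gives
         [cos (beta - xi') <= cos beta], against [Hlt]. *)
      assert (2 * sin xi' * sin beta <= 2 * (1 - cos xi') * cos beta).
      { rewrite <- K2; apply Rle_trans with ((d * cos beta) * sin beta); [| lra].
        apply Rmult_le_compat_r; lra. }
      lra. }
    rewrite Hxi0, ?cos_0, ?sin_0 in *.
    assert (Hbz : beta = 0).
    { destruct (Rle_lt_or_eq_dec 0 beta Hb0) as [H0 | H0]; [exfalso | easy].
      assert (0 < sin beta) by (apply sin_gt_0; lra); nra. }
    rewrite Hbz in Hsum; rewrite Hbz, cos_0 in K1; unfold beta in Hbz; lra.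
Qed.

(** By the headings, the four arcs add up to 0, when both words are straight, or to one full turn,
    which the displacements exclude. *)
Lemma CSC_unique_LSL_RSR (a : turn) (eta d xi eta' d' xi' : R) :
  0 <= eta < PI -> 0 <= xi < PI -> 0 <= d ->
  0 <= eta' < PI -> 0 <= xi' < PI -> 0 <= d' ->
  word_motion (CSC a eta d a xi) =
    word_motion (CSC (opposite a) eta' d' (opposite a) xi') ->
  eta + d + xi = eta' + d' + xi'.
Proof.
  intros He Hx Hd He' Hx' Hd' H; assert (HP := PI_RGT_0).
  rewrite !CSC_same_motion in H; injection H as E1 E2 Ec Es.
  apply turn_sign_cancel_opposite in E2, Es.
  destruct (angle_unique (eta + xi) (- (eta' + xi'))) as [k Hk].
  { now rewrite cos_neg. } { now rewrite sin_neg. }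
  destruct (turns_between k (-1) 2) as [k1 k2]; [simpl; lra |].
  assert (Hk01 : (k = 0 \/ k = 1)%Z) by lia; destruct Hk01 as [-> | ->].
  - replace eta with 0 in * by lra; replace xi with 0 in * by lra.
    replace eta' with 0 in * by lra; replace xi' with 0 in * by lra.
    rewrite cos_0 in E1; lra.
  - (* Projected on the direction at angle (eta + xi) / 2, the two
       displacements have opposite signs. *)
    assert (Hproj : forall e x r, 0 <= e < PI -> 0 <= x < PI -> 0 <= r -> 0 < e + x ->
      0 < (sin (e + x) + r * cos e) * cos ((e + x) / 2)
          + (1 - cos (e + x) + r * sin e) * sin ((e + x) / 2)).
    { intros e x r H1 H2 H3 H4.
      set (u := (e + x) / 2).
      assert (Hu : 0 < sin u) by (apply sin_gt_0; unfold u; lra).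
      assert (Hv : 0 <= cos (e - u)) by (apply cos_ge_0; unfold u; lra).
      replace (e + x) with (2 * u) by (unfold u; field).
      rewrite cos_minus in Hv; rewrite sin_2a, cos_2a_sin.
      assert (P := sin_mul_self u).
      match goal with |- 0 < ?g => replace g with (2 * sin u + r * (cos e * cos u + sin e * sin u)) end;
        [nra | ring [P]]. }
    assert (Hp := Hproj eta xi d He Hx Hd ltac:(lra)).
    assert (Hp' := Hproj eta' xi' d' He' Hx' Hd' ltac:(lra)).
    rewrite E1, E2 in Hp.
    replace ((eta + xi) / 2) with (PI - (eta' + xi') / 2) in Hp by lra.
    rewrite Rtrigo_facts.cos_pi_minus, Rtrigo_facts.sin_pi_minus in Hp; lra.
Qed.

Lemma cos_half_difference (x y : R) :
  cos ((x - y) / 2) - cos ((x + y) / 2) = 2 * sin (x / 2) * sin (y / 2).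
Proof.
  replace ((x - y) / 2) with (x / 2 - y / 2) by field.
  replace ((x + y) / 2) with (x / 2 + y / 2) by field.
  rewrite cos_minus, cos_plus; ring.
Qed.

Lemma sin_half_product_0 (x y : R) :
  0 <= x < PI -> 0 <= y < PI -> 2 * sin (x / 2) * sin (y / 2) = 0 -> x = 0 \/ y = 0.
Proof.
  intros Hx Hy H.
  destruct (Req_dec x 0) as [| Hx0]; [now left |].
  destruct (Req_dec y 0) as [| Hy0]; [now right |]; exfalso.
  assert (0 < sin (x / 2)) by (apply sin_gt_0; lra).
  assert (0 < sin (y / 2)) by (apply sin_gt_0; lra); nra.
Qed.

(** The headings give [eta + eta' = xi + xi' = 2 * u], the angle between the two segments. [I1] and
    [I3] are the displacement equation projected across and along the first segment, [I2] the one
    across the second. *)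
Lemma CSC_unique_LSR_RSL (a : turn) (eta d xi eta' d' xi' : R) :
  0 <= eta < PI -> 0 <= xi < PI -> 0 <= d ->
  0 <= eta' < PI -> 0 <= xi' < PI -> 0 <= d' ->
  word_motion (CSC a eta d (opposite a) xi) =
    word_motion (CSC (opposite a) eta' d' a xi') ->
  eta + d + xi = eta' + d' + xi'.
Proof.
  intros He Hx Hd He' Hx' Hd' H; assert (HP := PI_RGT_0).
  assert (Haa : a = opposite (opposite a)) by (now destruct a).
  assert (Hm := CSC_opposite_motion (opposite a) eta' d' xi'); rewrite <- Haa in Hm.
  rewrite Hm, CSC_opposite_motion in H.
  injection H as E1 E2 Ec Es.
  apply turn_sign_cancel_opposite in E2, Es.
  destruct (angle_unique (eta - xi) (- (eta' - xi'))) as [k Hk].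
  { now rewrite cos_neg. } { now rewrite sin_neg. }
  destruct (turns_between k (-1) 1) as [k1 k2]; [simpl; lra |].
  replace k with 0%Z in Hk by lia; clear k k1 k2.
  set (u := (eta + eta') / 2).
  assert (P := sin_mul_self eta).
  assert (Hsd : sin (eta' - xi') = - sin (eta - xi)) by lra.
  assert (X : d * cos eta + 2 * sin eta - 2 * sin (eta - xi) = d' * cos eta' + 2 * sin eta')
    by lra.
  assert (Y : d * sin eta + 2 - 2 * cos eta + 2 * cos (eta - xi)
              = - d' * sin eta' + 2 * cos eta') by lra.
  assert (HD : eta + eta' = 2 * u) by (unfold u; field).
  assert (I1 : d' * sin (2 * u) = 2 * (1 + cos (2 * u) - cos eta - cos xi)).
  { rewrite <- HD; replace xi with (eta - (eta - xi)) at 1 by ring.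
    rewrite sin_plus, cos_plus, (cos_minus eta).
    transitivity (sin eta * (d' * cos eta' + 2 * sin eta')
                  - cos eta * (- d' * sin eta' + 2 * cos eta')
                  + 2 * (cos eta * cos eta' - sin eta * sin eta')); [ring |].
    rewrite <- X, <- Y; ring [P]. }
  assert (I3 : d = d' * cos (2 * u) + 2 * sin (2 * u) - 2 * (sin eta + sin xi)).
  { rewrite <- HD; replace xi with (eta - (eta - xi)) at 1 by ring.
    rewrite sin_plus, cos_plus, (sin_minus eta).
    transitivity (cos eta * (d' * cos eta' + 2 * sin eta')
                  + sin eta * (- d' * sin eta' + 2 * cos eta')
                  - 2 * (sin eta + (sin eta * cos (eta - xi) - cos eta * sin (eta - xi))));
      [| ring].
    rewrite <- X, <- Y; ring [P]. }
  assert (Hsu : 0 <= sin u) by (apply sin_ge_0; unfold u; lra).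
  assert (Hhalf : forall x, 0 <= x < PI -> 0 <= sin (x / 2))
    by (intros x Hx0; apply sin_ge_0; lra).
  assert (Q1 := cos_half_difference eta eta').
  assert (Q2 := cos_half_difference xi xi').
  replace ((xi + xi') / 2) with u in Q2 by (unfold u; lra); fold u in Q1.
  set (v := (eta - eta') / 2) in *; set (w := (xi - xi') / 2) in *.
  assert (Hv : 0 <= cos v - cos u).
  { rewrite Q1; assert (A1 := Hhalf eta He); assert (A2 := Hhalf eta' He'); nra. }
  assert (Hw : 0 <= cos w - cos u).
  { rewrite Q2; assert (A1 := Hhalf xi Hx); assert (A2 := Hhalf xi' Hx'); nra. }
  assert (P' := sin_mul_self eta').
  assert (I2 : d * sin (2 * u) = 2 * (1 + cos (2 * u) - cos eta' - cos xi')).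
  { rewrite <- HD; replace xi' with (eta' + (eta - xi)) at 1 by lra.
    rewrite sin_plus, !cos_plus.
    transitivity (cos eta' * (d * sin eta + 2 - 2 * cos eta + 2 * cos (eta - xi))
                  + sin eta' * (d * cos eta + 2 * sin eta - 2 * sin (eta - xi))
                  - 2 * cos eta' + 2 * (cos eta * cos eta' - sin eta * sin eta')
                  - 2 * (cos eta' * cos (eta - xi) - sin eta' * sin (eta - xi))); [ring |].
    rewrite X, Y; ring [P']. }
  assert (S1 : cos eta + cos eta' = 2 * cos u * cos v).
  { replace eta with (u + v) by (unfold u, v; field).
    replace eta' with (u - v) by (unfold u, v; field).
    rewrite cos_plus, cos_minus; ring. }
  assert (S2 : cos xi + cos xi' = 2 * cos u * cos w).
  { assert (Hu' : u = (xi + xi') / 2) by (unfold u; lra).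
    replace xi with (u + w) by (rewrite Hu'; unfold w; field).
    replace xi' with (u - w) by (rewrite Hu'; unfold w; field).
    rewrite cos_plus, cos_minus; ring. }
  rewrite sin_2a in I1, I2; rewrite cos_2a_cos in I1, I2.
  (* The sum of [I1] and [I2], by [S1] and [S2]. The second factor has three nonnegative terms, so
     if it vanishes they all do. *)
  assert (Hprod : cos u * ((d + d') * sin u + 2 * (cos v - cos u) + 2 * (cos w - cos u)) = 0)
    by lra.
  apply Rmult_integral in Hprod; destruct Hprod as [Hcu | Hsumz].
  - (* Then eta + eta' = pi, and I3 leaves no room for eta > 0. *)
    assert (Hu : u = PI / 2).
    { destruct (Rtotal_order u (PI / 2)) as [Hlt | [Heq | Hgt]]; [exfalso | exact Heq | exfalso].
      - assert (0 < cos u) by (apply cos_gt_0; unfold u in *; lra); lra.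
      - assert (cos u < 0) by (apply cos_lt_0; unfold u in *; lra); lra. }
    replace (2 * u) with PI in I3 by lra; rewrite cos_PI, sin_PI in I3.
    assert (A1 : 0 < eta) by lra.
    assert (A2 : 0 < sin eta) by (apply sin_gt_0; lra).
    assert (A3 : 0 <= sin xi) by (apply sin_ge_0; lra); lra.
  - assert (Hds : 0 <= (d + d') * sin u) by (apply Rmult_le_pos; lra).
    assert (Hcv : cos v - cos u = 0) by lra; assert (Hcw : cos w - cos u = 0) by lra.
    rewrite Q1 in Hcv; rewrite Q2 in Hcw.
    apply sin_half_product_0 in Hcv; trivial; apply sin_half_product_0 in Hcw; trivial.
    destruct (Req_dec u 0) as [Hu0 | Hu0].
    + assert (eta = 0) by (unfold u in Hu0; lra); assert (xi = 0) by (unfold u in Hu0; lra).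
      subst eta xi; rewrite Hu0, Rmult_0_r, cos_0, sin_0 in I3; unfold u in Hu0; lra.
    + assert (Hsu' : 0 < sin u) by (apply sin_gt_0; unfold u in *; lra).
      assert (Hprod : (d + d') * sin u = 0) by lra.
      apply Rmult_integral in Hprod; destruct Hprod as [Hprod |]; [| lra].
      replace d with 0 in * by lra; replace d' with 0 in * by lra.
      assert (Hcu2 : cos (2 * u) < 1).
      { rewrite cos_2a_sin; assert (K := Rmult_lt_0_compat _ _ Hsu' Hsu'); lra. }
      rewrite cos_2a_cos in Hcu2.
      (* Two null arcs in the same word would give [cos (2 * u) = 1]; otherwise both words are one
         and the same arc of measure [2 * u]. *)
      destruct Hcv as [-> | ->], Hcw as [-> | ->]; try lra.
      * rewrite cos_0 in I1; lra.
      * rewrite cos_0 in I2; lra.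
Qed.

(** Mirror images, exchange of the two words and reversal ([Hrev]) reduce the sixteen pairs of types
    to equal types and the three comparisons above. For equal types, the sums of arcs are below a
    full turn, so they cannot differ by one. *)
Lemma CSC_unique (a b a' b' : turn) (eta d xi eta' d' xi' : R) :
  0 <= eta < PI -> 0 <= xi < PI -> 0 <= d ->
  0 <= eta' < PI -> 0 <= xi' < PI -> 0 <= d' ->
  word_motion (CSC a eta d b xi) = word_motion (CSC a' eta' d' b' xi') ->
  eta + d + xi = eta' + d' + xi'.
Proof.
  intros He Hx Hd He' Hx' Hd' H.
  assert (Hsame : a' = a -> b' = b -> eta + d + xi = eta' + d' + xi').
  { intros -> ->.
    destruct (CSC_length_mod_2PI a b _ _ _ _ _ _ Hd Hd' H) as [-> [k Hk]].
    destruct (turns_between k (-1) 1) as [k1 k2]; [simpl; lra |].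
    replace k with 0%Z in Hk by lia; lra. }
  assert (Hrev : word_motion (CSC b xi d a eta) = word_motion (CSC b' xi' d' a' eta'))
    by (now rewrite (CSC_reverse_motion a b), H, <- CSC_reverse_motion).
  destruct a, b, a', b'; try (apply Hsame; reflexivity); clear Hsame;
    first
    [ now apply (CSC_unique_LSL_RSR Left) | now apply (CSC_unique_LSL_RSR Right)
    | now apply (CSC_unique_LSR_RSL Left) | now apply (CSC_unique_LSR_RSL Right)
    | now apply (CSC_unique_LSL_LSR Left) | now apply (CSC_unique_LSL_LSR Right)
    | symmetry; now apply (CSC_unique_LSL_LSR Left)
    | symmetry; now apply (CSC_unique_LSL_LSR Right)
    | enough (xi + d + eta = xi' + d' + eta') by lra;
      first [ now apply (CSC_unique_LSL_LSR Left) | now apply (CSC_unique_LSL_LSR Right)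
            | symmetry; now apply (CSC_unique_LSL_LSR Left)
            | symmetry; now apply (CSC_unique_LSL_LSR Right)] ].
Qed.

(** * Lengths of CSC and CCC paths *)

Lemma Rbar_le_lub_pair (s x y : Rbar) :
  Rbar_le s (Rbar_lub (fun l => l = x \/ l = y)) -> Rbar_le s x \/ Rbar_le s y.
Proof.
  unfold Rbar_lub; destruct (Rbar_ex_lub _) as [m [Hub Hm]]; simpl; intros Hs.
  destruct (Rbar_le_lt_dec s x) as [Hx | Hx]; [now left |].
  destruct (Rbar_le_lt_dec s y) as [Hy | Hy]; [now right |]; exfalso.
  destruct (Rbar_le_lt_dec x y) as [Hxy | Hxy].
  - apply (Rbar_lt_not_le _ _ Hy), (Rbar_le_trans _ m); [exact Hs |].
    apply Hm; intros l [-> | ->]; [exact Hxy | apply Rbar_le_refl].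
  - apply (Rbar_lt_not_le _ _ Hx), (Rbar_le_trans _ m); [exact Hs |].
    apply Hm; intros l [-> | ->]; [apply Rbar_le_refl | now apply Rbar_lt_le].
Qed.

(** If all elements exceeded [s], so would the least of them, which bounds [E] from below; the list
    [L] is what makes a least one available. *)
Lemma Rbar_glb_finite_le (E : Rbar -> Prop) (L : list Rbar) (s : R) :
  (forall x, E x -> In x L) -> Rbar_le (Rbar_glb E) s ->
  exists x, E x /\ Rbar_le x s.
Proof.
  intros HL Hs; apply NNPP; intros Hno.
  assert (Hb : exists b, Rbar_lt s b /\ forall x, In x L -> E x -> Rbar_le b x).
  { clear HL; induction L as [| y L [b [Hsb Hb]]].
    - exists p_infty; split; [exact I | intros x []].
    - destruct (classic (E y)) as [Hy | Hy].
      + exists (Rbar_min b y); split.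
        * apply Rbar_min_case; [exact Hsb |].
          apply Rbar_not_le_lt; intros Hle; apply Hno; now exists y.
        * intros x [<- | Hx] HE; [apply Rbar_min_r |].
          apply Rbar_le_trans with b; [apply Rbar_min_l | now apply Hb].
      + exists b; split; [exact Hsb |].
        intros x [<- | Hx] HE; [contradiction | now apply Hb]. }
  destruct Hb as [b [Hsb Hb]]; apply (Rbar_lt_not_le _ _ Hsb).
  apply Rbar_le_trans with (Rbar_glb E); [| exact Hs].
  unfold Rbar_glb; destruct (Rbar_ex_glb E) as [m [Hlb Hm]]; simpl.
  apply Hm; intros x HE; now apply Hb; [apply HL |].
Qed.

Lemma arc_zero (a : turn) : word_motion [Arc a 0] = (RtoC 0, RtoC 1).
Proof.
  unfold word_motion, motion_comp, piece_motion; simpl.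
  rewrite Rmult_0_r, cis_0; f_equal; ring.
Qed.

Lemma arc_full_turn (a : turn) (x : R) :
  word_motion [Arc a (x + 2 * PI)] = word_motion [Arc a x].
Proof.
  unfold word_motion, piece_motion.
  now rewrite !cis_turn, cos_plus, sin_plus, cos_2PI, sin_2PI,
    !Rmult_1_r, !Rmult_0_r, Rminus_0_r, Rplus_0_r.
Qed.

Lemma motion_comp_id_l (m : motion) : motion_comp (RtoC 0, RtoC 1) m = m.
Proof. destruct m; unfold motion_comp; simpl; f_equal; ring. Qed.

Lemma motion_comp_id_r (m : motion) : motion_comp m (RtoC 0, RtoC 1) = m.
Proof. destruct m; unfold motion_comp; simpl; f_equal; ring. Qed.

(** [c] is the turn of the middle arc aimed at, chosen independently of [a] and [b]. An outer arc of
    turn [c] is to be prolonged; one of the other turn is a counter-turn already made, next to a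
    null arc. *)
Lemma reach_CSC_or_CCC (a b c : turn) (eta d xi l : R) :
  0 <= eta < PI -> 0 <= d -> 0 <= xi < PI -> eta + d + xi <= l ->
  reach (word_motion (CSC a eta d b xi)) l \/
  exists x theta y, 0 <= x < 2 * PI /\ 0 <= theta < 2 * PI /\ 0 <= y < 2 * PI /\
    word_motion [Arc (opposite c) x; Arc c theta; Arc (opposite c) y] =
      word_motion (CSC a eta d b xi) /\
    x + theta + y < l.
Proof.
  intros He Hd Hx Hl; assert (HP := PI_RGT_0).
  (* One of the two parts is null, so they commute: the counter-turn can be put first at the start
     of the word and last at its end. *)
  assert (Hsplit : forall e u, 0 <= u < PI -> exists alpha eta',
            0 <= alpha < PI /\ 0 <= eta' < PI /\ alpha + eta' = u /\
            (alpha = 0 \/ eta' = 0) /\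
            word_motion [Arc e u] =
              motion_comp (word_motion [Arc (opposite c) alpha]) (word_motion [Arc c eta']) /\
            word_motion [Arc e u] =
              motion_comp (word_motion [Arc c eta']) (word_motion [Arc (opposite c) alpha])).
  { intros e u Hu.
    assert (Hec : e = c \/ e = opposite c) by (destruct e, c; auto).
    destruct Hec as [-> | ->].
    - exists 0, u; rewrite arc_zero, motion_comp_id_l, motion_comp_id_r.
      repeat split; auto; lra.
    - exists u, 0; rewrite arc_zero, motion_comp_id_l, motion_comp_id_r.
      repeat split; auto; lra. }
  destruct (Hsplit a eta He) as (alpha & eta' & Ha & He' & Hae & Hz & Hm & _).
  destruct (Hsplit b xi Hx) as (beta & xi' & Hb & Hx' & Hbx & Hz' & _ & Hm').
  assert (Hw : word_motion (CSC a eta d b xi) =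
            word_motion ([Arc (opposite c) alpha] ++ [Arc c eta'; Seg d; Arc c xi']
                           ++ [Arc (opposite c) beta])).
  { change (word_motion ([Arc a eta] ++ [Seg d] ++ [Arc b xi]) =
            word_motion ([Arc (opposite c) alpha] ++ ([Arc c eta'] ++ [Seg d] ++ [Arc c xi'])
                           ++ [Arc (opposite c) beta])).
    rewrite !word_motion_app, Hm, Hm'; now rewrite !motion_comp_assoc. }
  rewrite Hw.
  destruct (reach_CSC_to_CCC c alpha eta' d xi' beta l) as [H | (p & q & Hp & Hq & Hlt & H)];
    try lra; [now left | right].
  exists (alpha + (p - eta')), (p + q), (q - xi' + beta).
  repeat split; try exact H; lra.
Qed.

(* Reflects the middle circle in the line through the two outer centers. *)
Lemma flip_middle_arc (a : turn) (theta : R) :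
  word_motion [Arc (opposite a) theta] =
  word_motion [Arc a (PI - theta); Arc (opposite a) (2 * PI - theta); Arc a (PI - theta)].
Proof.
  assert (Ha := turn_sign_sq a); assert (Ht := sin_mul_self theta).
  unfold word_motion, motion_comp, piece_motion; cbn [fst snd].
  rewrite !cis_turn, turn_sign_opposite, !cos_minus, !sin_minus,
    cos_PI, sin_PI, cos_2PI, sin_2PI.
  f_equal; apply C_ext; simpl; ring [Ha Ht].
Qed.

Definition CCC (a : turn) (eta theta xi : R) : list piece :=
  [Arc a eta; Arc (opposite a) theta; Arc a xi].

Lemma flip_CCC (a : turn) (eta theta xi : R) :
  word_motion (CCC a eta theta xi) =
  word_motion (CCC a (eta + (PI - theta)) (2 * PI - theta) (PI - theta + xi)).
Proof.
  change (word_motion ([Arc a eta] ++ [Arc (opposite a) theta] ++ [Arc a xi]) =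
          word_motion ([Arc a (eta + (PI - theta))] ++ [Arc (opposite a) (2 * PI - theta)]
                         ++ [Arc a (PI - theta + xi)])).
  rewrite !word_motion_app, !arc_split, flip_middle_arc.
  change (motion_comp (word_motion [Arc a eta])
    (motion_comp (word_motion ([Arc a (PI - theta)] ++ [Arc (opposite a) (2 * PI - theta)]
                                ++ [Arc a (PI - theta)])) (word_motion [Arc a xi])) =
    motion_comp (word_motion ([Arc a eta] ++ [Arc a (PI - theta)]))
      (motion_comp (word_motion [Arc (opposite a) (2 * PI - theta)])
         (word_motion ([Arc a (PI - theta)] ++ [Arc a xi])))).
  now rewrite !word_motion_app, !motion_comp_assoc.
Qed.

Lemma CCC_eq_arcs (a : turn) (eta theta xi eta' theta' xi' : R) :
  word_motion [Arc a eta] = word_motion [Arc a eta'] ->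
  word_motion [Arc (opposite a) theta] = word_motion [Arc (opposite a) theta'] ->
  word_motion [Arc a xi] = word_motion [Arc a xi'] ->
  word_motion (CCC a eta theta xi) = word_motion (CCC a eta' theta' xi').
Proof.
  intros H1 H2 H3.
  change (word_motion ([Arc a eta] ++ [Arc (opposite a) theta] ++ [Arc a xi]) =
          word_motion ([Arc a eta'] ++ [Arc (opposite a) theta'] ++ [Arc a xi'])).
  now rewrite !word_motion_app, H1, H2, H3.
Qed.

Lemma reduce_arc (a : turn) (x : R) :
  0 <= x < 4 * PI -> exists y, 0 <= y < 2 * PI /\ word_motion [Arc a y] = word_motion [Arc a x].
Proof.
  intros Hx; destruct (Rlt_dec x (2 * PI)) as [H | H]; [exists x; split; [lra | easy] |].
  exists (x - 2 * PI); split; [lra |].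
  rewrite <- arc_full_turn; now replace (x - 2 * PI + 2 * PI) with x by ring.
Qed.

(** If [theta] is below [PI], the reflected middle arc [2 * PI - theta] exceeds it. The outer arcs
    grow and are reduced modulo a full turn. *)
Lemma CCC_with_long_arc (a : turn) (eta theta xi : R) :
  0 <= eta < 2 * PI -> 0 <= theta < 2 * PI -> 0 <= xi < 2 * PI ->
  exists eta' theta' xi',
    0 <= eta' < 2 * PI /\ 0 <= theta' < 2 * PI /\ 0 <= xi' < 2 * PI /\
    word_motion (CCC a eta' theta' xi') = word_motion (CCC a eta theta xi) /\
    (PI <= eta' \/ PI <= theta' \/ PI <= xi').
Proof.
  intros He Ht Hx; assert (HP := PI_RGT_0).
  destruct (Rle_dec PI eta) as [H1 | H1]; [exists eta, theta, xi; tauto |].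
  destruct (Rle_dec PI theta) as [H2 | H2]; [exists eta, theta, xi; tauto |].
  destruct (Rle_dec PI xi) as [H3 | H3]; [exists eta, theta, xi; tauto |].
  rewrite flip_CCC.
  (* The reflected middle arc would be a full turn, which is excluded; it is dropped, and the long
     arc is then [eta + PI]. *)
  destruct (Req_dec theta 0) as [-> | H0].
  - exists (eta + (PI - 0)), 0, (PI - 0 + xi).
    split; [lra |]; split; [lra |]; split; [lra |]; split; [| left; lra].
    apply CCC_eq_arcs; trivial.
    rewrite <- arc_full_turn; f_equal; f_equal; f_equal; ring.
  - destruct (reduce_arc a (eta + (PI - theta))) as (eta' & He' & Hme); [lra |].
    destruct (reduce_arc a (PI - theta + xi)) as (xi' & Hx' & Hmx); [lra |].
    exists eta', (2 * PI - theta), xi'.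
    split; [lra |]; split; [lra |]; split; [lra |]; split; [| right; left; lra].
    now apply CCC_eq_arcs.
Qed.

Lemma total_ge0 (w : list piece) : nonneg_word w -> 0 <= total w.
Proof. induction 1 as [| p w Hp _ IH]; simpl; lra. Qed.

Lemma null_word_motion (w : list piece) :
  nonneg_word w -> total w = 0 -> word_motion w = (RtoC 0, RtoC 1).
Proof.
  induction 1 as [| p w Hp Hw IH]; simpl; intros H0; [easy |].
  assert (H := total_ge0 w Hw); rewrite IH, motion_comp_id_r by lra.
  destruct p as [a eta | d]; simpl in *; [replace eta with 0 by lra | now replace d with 0 by lra].
  rewrite Rmult_0_r, cis_0; f_equal; ring.
Qed.

(** * Ranges of lengths above the CSC and CCC lengths *)

Section Lengths.

Variable kappa : R.
Hypothesis hkappa : 0 < kappa.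
Variables X Y : tangent_bundle.
Hypothesis hX : oriented_point X.

Hypothesis hXY : X <> Y.

Lemma total_gt0 (w : list piece) :
  nonneg_word w -> word_motion w = relative_motion kappa X Y -> 0 < total w.
Proof.
  intros Hw Hm; destruct (Rle_lt_or_eq_dec _ _ (total_ge0 w Hw)) as [H | H]; [exact H |].
  exfalso; apply hXY; apply (word_end_relative kappa hkappa [] X Y hX).
  rewrite <- Hm; symmetry; now apply null_word_motion.
Qed.

Lemma path_of_reach (s : R) :
  reach (relative_motion kappa X Y) (kappa * s) ->
  exists g, Gamma kappa X Y g /\ path_length g = s.
Proof.
  intros (w & Hw & Hm & Ht).
  destruct (path_of_motion kappa hkappa w X Y hX Hw) as (g & HG & _ & Hg); trivial.
  - now apply total_gt0.
  - exists g; split; [exact HG |]; rewrite Hg, Ht; field; lra.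
Qed.

Lemma CCC_lengths_iff (a : turn) (l : R) :
  CCC_lengths kappa X Y a l <->
  exists eta theta xi,
    0 <= eta < 2 * PI /\ 0 <= theta < 2 * PI /\ 0 <= xi < 2 * PI /\
    word_motion (CCC a eta theta xi) = relative_motion kappa X Y /\
    kappa * l = eta + theta + xi.
Proof.
  split.
  - intros (g & eta & theta & xi & HG & Hg & He & Ht & Hx & ->).
    destruct (motion_of_path kappa hkappa _ X Y g hX HG Hg) as (_ & Hm & Hl & Hpos).
    simpl in Hl, Hpos; destruct Hg as [Hnn _].
    inversion_clear Hnn as [| ? ? N1 Hnn']; inversion_clear Hnn' as [| ? ? N2 Hnn''].
    inversion_clear Hnn'' as [| ? ? N3 _]; simpl in N1, N2, N3.
    exists eta, theta, xi; repeat split; trivial.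
    rewrite Hl; field; lra.
  - intros (eta & theta & xi & He & Ht & Hx & Hm & Hl).
    assert (Hnn : nonneg_word (CCC a eta theta xi))
      by (unfold CCC; repeat apply Forall_cons; try apply Forall_nil; simpl; lra).
    destruct (path_of_motion kappa hkappa (CCC a eta theta xi) X Y hX) as (g & HG & Hg & Hgl);
      trivial.
    + now apply total_gt0.
    + exists g, eta, theta, xi.
      split; [exact HG |]; split; [exact Hg |]; do 3 (split; [lra |]).
      rewrite Hgl; simpl; apply Rmult_eq_reg_l with kappa; [| lra].
      rewrite Hl; field; lra.
Qed.

(** [s] bounds every length of the type, hence also that of a word with a long arc, whichever of the
    two paths this is. *)
Lemma reach_from_CCC_longer (a : turn) (s : R) :
  Rbar_le (CCC_longer kappa X Y a) s -> reach (relative_motion kappa X Y) (kappa * s).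
Proof.
  unfold CCC_longer; intros Hs.
  destruct (Lub_Rbar_correct (CCC_lengths kappa X Y a)) as [Hub Hlub].
  destruct (classic (exists l, CCC_lengths kappa X Y a l)) as [[l0 Hl0] | Hno].
  - assert (Hle : forall l, CCC_lengths kappa X Y a l -> l <= s).
    { intros l Hl; specialize (Hub l Hl).
      destruct (Lub_Rbar (CCC_lengths kappa X Y a)); simpl in *; lra || contradiction. }
    apply CCC_lengths_iff in Hl0.
    destruct Hl0 as (eta0 & theta0 & xi0 & H1 & H2 & H3 & Hm0 & _).
    destruct (CCC_with_long_arc a eta0 theta0 xi0 H1 H2 H3)
      as (eta & theta & xi & He & Ht & Hx & Hm & Hlong).
    rewrite Hm0 in Hm; assert (HP := PI_RGT_0).
    assert (Hl : (eta + theta + xi) / kappa <= s).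
    { apply Hle, CCC_lengths_iff; exists eta, theta, xi; repeat split; try tauto.
      field; lra. }
    assert (Hlk : eta + theta + xi <= kappa * s).
    { apply Rle_div_l in Hl; lra. }
    assert (Hnn : nonneg_word (CCC a eta theta xi))
      by (unfold CCC; repeat apply Forall_cons; try apply Forall_nil; simpl; lra).
    rewrite <- Hm; destruct Hlong as [HL | [HL | HL]].
    + apply (reach_ray [] [Arc (opposite a) theta; Arc a xi] a eta); trivial; simpl; lra.
    + apply (reach_ray [Arc a eta] [Arc a xi] (opposite a) theta); trivial; simpl; lra.
    + apply (reach_ray [Arc a eta; Arc (opposite a) theta] [] a xi); trivial; simpl; lra.
  (* On the empty set the supremum is [m_infty], which [CCC_longer] turns into [p_infty]; no real
     [s] lies above it. *)
  - exfalso; assert (Hm : Rbar_le (Lub_Rbar (CCC_lengths kappa X Y a)) m_infty)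
      by (apply Hlub; intros l Hl; exfalso; apply Hno; now exists l).
    destruct (Lub_Rbar (CCC_lengths kappa X Y a)); simpl in *; contradiction.
Qed.

Lemma CSC_lengths_motion (a b : turn) (l : R) :
  CSC_lengths kappa X Y a b l ->
  exists eta d xi, 0 <= eta /\ 0 <= d /\ 0 <= xi /\
    word_motion (CSC a eta d b xi) = relative_motion kappa X Y /\
    kappa * l = eta + d + xi /\ exists g, Gamma kappa X Y g /\ path_length g = l.
Proof.
  intros (g & eta & d & xi & HG & Hg & _ & _ & ->).
  destruct (motion_of_path kappa hkappa _ X Y g hX HG Hg) as (Hnn & Hm & Hl & _).
  simpl in Hl, Hm.
  inversion_clear Hnn as [| ? ? N1 Hnn']; inversion_clear Hnn' as [| ? ? N2 Hnn''].
  inversion_clear Hnn'' as [| ? ? N3 _]; simpl in N1, N2, N3.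
  exists eta, (kappa * d), xi; repeat split; trivial; [| now exists g].
  rewrite Hl; field; lra.
Qed.

(* The lengths differ by multiples of 2 pi / kappa, so the infimum is attained. *)
Lemma CSC_length_attained (a b : turn) (s : R) :
  Rbar_le (CSC_length kappa X Y a b) s ->
  exists l, CSC_length kappa X Y a b = Finite l /\ CSC_lengths kappa X Y a b l.
Proof.
  unfold CSC_length; intros Hs; assert (HP := PI_RGT_0).
  destruct (Glb_Rbar_correct (CSC_lengths kappa X Y a b)) as [Hlb Hglb].
  assert (H0 : Rbar_le 0 (Glb_Rbar (CSC_lengths kappa X Y a b))).
  { apply Hglb; intros l Hl.
    destruct (CSC_lengths_motion a b l Hl) as (eta & d & xi & H1 & H2 & H3 & _ & Hl' & _).
    simpl; nra. }
  destruct (Glb_Rbar (CSC_lengths kappa X Y a b)) as [m | |]; simpl in Hs, H0; try contradiction.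
  assert (Hstep : 0 < 2 * PI / kappa) by (apply Rdiv_lt_0_compat; lra).
  destruct (classic (exists l, CSC_lengths kappa X Y a b l /\ l < m + 2 * PI / kappa))
    as [[l [Hl Hlm]] | Hno].
  - exists l; split; [| exact Hl]; f_equal; apply Rle_antisym; [exact (Hlb l Hl) |].
    apply (Hglb (Finite l)); intros l' Hl'; simpl.
    apply Rnot_lt_le; intros Hlt; assert (Hm' := Hlb l' Hl'); simpl in Hm'.
    destruct (CSC_lengths_motion a b l Hl) as (eta & d & xi & _ & Hd & _ & M & L & _).
    destruct (CSC_lengths_motion a b l' Hl') as (eta' & d' & xi' & _ & Hd' & _ & M' & L' & _).
    rewrite <- M' in M.
    destruct (CSC_length_mod_2PI a b _ _ _ _ _ _ Hd Hd' M) as [-> [k Hk]].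
    assert (Hdiff : l - l' = 2 * PI / kappa * IZR k).
    { apply Rmult_eq_reg_l with kappa; [| lra].
      transitivity (2 * PI * IZR k); [lra | field; lra]. }
    assert (Hk0 : (0 < k < 1)%Z) by (split; apply lt_IZR; nra).
    lia.
  - exfalso; assert (Hle : Rbar_le (m + 2 * PI / kappa) m); [| simpl in Hle; lra].
    apply Hglb; intros l Hl; apply Rnot_lt_le; intros Hlt; apply Hno; now exists l.
Qed.

End Lengths.

Theorem proposition3 (kappa : R) (hkappa : 0 < kappa)
    (X Y : tangent_bundle) (hX : oriented_point X) (hY : oriented_point Y)
    (hXY : X <> Y) (gm : path) (hgm : shortest kappa X Y gm)
    (hnabla : in_nabla_O kappa X Y gm) (s : R)
    (hs : (path_length gm <= s /\ Rbar_le (Finite s) (ell1 kappa X Y)) \/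
          Rbar_le (ell2 kappa X Y gm) (Finite s)) :
  exists g : path, Gamma kappa X Y g /\ path_length g = s.
Proof.
  destruct hgm as [HG Hmin]; destruct hnabla as [(a & b & eta & d & xi & Htype) HnO].
  assert (Heta : eta < PI).
  { apply Rnot_le_lt; intros H; apply HnO; exists a, b, eta, d, xi; tauto. }
  assert (Hxi : xi < PI).
  { apply Rnot_le_lt; intros H; apply HnO; exists a, b, eta, d, xi; tauto. }
  destruct (motion_of_path kappa hkappa _ X Y gm hX HG Htype) as (Hnn & Hm & Hl & Hpos).
  simpl in Hl, Hpos.
  change (word_motion (CSC a eta (kappa * d) b xi) = relative_motion kappa X Y) in Hm.
  inversion_clear Hnn as [| ? ? N1 Hnn']; inversion_clear Hnn' as [| ? ? N2 Hnn''].
  inversion_clear Hnn'' as [| ? ? N3 _]; simpl in N1, N2, N3.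
  set (d' := kappa * d) in *; set (lm := path_length gm) in *.
  assert (Hlk : kappa * lm = eta + d' + xi) by (rewrite Hl; field; lra).
  assert (Hlpos : 0 < lm) by nra; assert (HP := PI_RGT_0).
  assert (Hstep : 0 < 2 * PI / kappa) by (apply Rdiv_lt_0_compat; lra).
  destruct hs as [[Hs1 Hs2] | Hs].
  - apply path_of_reach; trivial.
    (* [c] is the turn of the middle arc of a CCC type all of whose lengths are at least [s],
       vacuously so if there is no such path. *)
    assert (Hc : exists c, Rbar_le s (CCC_shorter kappa X Y (opposite c))).
    { apply Rbar_le_lub_pair in Hs2; destruct Hs2 as [H | H]; [now exists Right | now exists Left]. }
    destruct Hc as [c Hc]; rewrite <- Hm.
    destruct (reach_CSC_or_CCC a b c eta d' xi (kappa * s))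
      as [H | (x & theta & y & Hx & Ht & Hy & HM & Hlt)]; try lra; [nra | exact H | exfalso].
    (* The deformation would end in a CCC path of this very type that is shorter than [s]. *)
    assert (Hin : CCC_lengths kappa X Y (opposite c) ((x + theta + y) / kappa)).
    { apply CCC_lengths_iff; trivial; exists x, theta, y; repeat split; try tauto.
      - unfold CCC; replace (opposite (opposite c)) with c by (now destruct c); now rewrite HM.
      - field; lra. }
    assert (Hle := Rbar_le_trans _ _ _ Hc (proj1 (Glb_Rbar_correct _) _ Hin)); simpl in Hle.
    apply Rle_div_r in Hle; lra.
  - apply (Rbar_glb_finite_le _
      [Finite (lm + 2 * PI / kappa); CCC_longer kappa X Y Left; CCC_longer kappa X Y Right;
       CSC_length kappa X Y Right Right; CSC_length kappa X Y Right Left;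
       CSC_length kappa X Y Left Right; CSC_length kappa X Y Left Left]) in Hs.
    2: { intros x [-> | [-> | [-> | [([|] & [|] & ->) _]]]]; simpl; tauto. }
    destruct Hs as [x [Hx Hxs]].
    apply path_of_reach; trivial.
    destruct Hx as [-> | [-> | [-> | [(a' & b' & ->) Hne]]]].
    + simpl in Hxs; fold lm in Hxs; apply reach_full_turn with (kappa * lm).
      * exists (CSC a eta d' b xi); repeat split; trivial; [| simpl; lra].
        repeat apply Forall_cons; try apply Forall_nil; simpl; lra.
      * apply Rmult_le_compat_l with (r := kappa) in Hxs; [| lra].
        replace (kappa * (lm + 2 * PI / kappa)) with (kappa * lm + 2 * PI) in Hxs
          by (field; lra); lra.
    + now apply (reach_from_CCC_longer kappa hkappa X Y hX hXY Left).
    + now apply (reach_from_CCC_longer kappa hkappa X Y hX hXY Right).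
    + destruct (CSC_length_attained kappa hkappa X Y hX a' b' s Hxs) as (l & El & Hin).
      rewrite El in Hne, Hxs; simpl in Hxs.
      destruct (CSC_lengths_motion kappa hkappa X Y hX a' b' l Hin)
        as (eta' & d'' & xi' & He' & Hd' & Hx' & HM & HL & _).
      assert (Hnn : nonneg_word (CSC a' eta' d'' b' xi'))
        by (repeat apply Forall_cons; try apply Forall_nil; simpl; lra).
      assert (Hls : kappa * l <= kappa * s) by (apply Rmult_le_compat_l; lra).
      rewrite <- HM.
      destruct (Rle_dec PI eta') as [H1 | H1].
      { apply (reach_ray [] [Seg d''; Arc b' xi'] a' eta'); trivial; simpl; lra. }
      destruct (Rle_dec PI xi') as [H2 | H2].
      { apply (reach_ray [Arc a' eta'; Seg d''] [] b' xi'); trivial; simpl; lra. }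
      (* All arcs are now below [PI], so uniqueness gives this path the length of [gm], a value
         removed from the set defining [ell2]. *)
      exfalso; apply Hne; f_equal; apply Rmult_eq_reg_l with kappa; [| lra].
      fold lm; rewrite HL, Hlk; symmetry; apply (CSC_unique a b a' b'); try lra.
      now rewrite Hm.
Qed.
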